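(* For every $\alpha>\frac8\pi$ there exists a unique non-negative function $\zeta\in L^2$ satisfying the equation $\zeta=\varPhi(\zeta)$.
   Context: $L^2$ denotes $L^2(0,\pi/2)$ with norm $\|f\|=\big(\int_0^{\pi/2}|f(\sigma)|^2\,d\sigma\big)^{1/2}$. The kernel is $K(s,\sigma)=\log\Big|\frac{\sin(s+\sigma)}{\sin(s-\sigma)}\Big|$ for $s,\sigma\in(0,\pi/2)$, $s\neq\sigma$, and for $w\in L^2$ the operator $H$ is $(Hw)(\sigma)=\frac1\pi\int_0^{\pi/2}K(s,\sigma)\,w(s)\,ds$, $\sigma\in[0,\pi/2]$. For a parameter $\alpha>0$ (the reduced Froude number) the nonlinear operator $\varPhi$ is defined for $\zeta\in L^2$ by $$\varPhi(\zeta)(\sigma)=\frac{3}{\alpha\pi}\,\frac{\sin\big(\sigma+\frac13(H\zeta)(\sigma)\big)\cot\sigma}{\exp\int_0^\sigma\zeta(s)\,ds},\qquad\sigma\in(0,\pi/2].$$ *)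

(* Defs.v *)
From HB Require Import structures.
From mathcomp Require Import all_boot all_order all_algebra.
From mathcomp Require Import all_classical all_reals all_analysis.
Set Implicit Arguments. Unset Strict Implicit. Unset Printing Implicit Defensive.
Import Order.TTheory GRing.Theory Num.Theory.
Import numFieldNormedType.Exports.
Local Open Scope classical_set_scope.
Local Open Scope ring_scope.

Section Defs.
Variable R : realType.
Notation mu := (@lebesgue_measure R).

Definition I0 : set R := `]0, pi / 2[.

Definition inL2 (f : R -> R) : Prop :=
  measurable_fun I0 f /\ mu.-integrable I0 (fun x => ((f x) ^+ 2)%:E).

(* K(s,sigma) = log | sin(s+sigma) / sin(s-sigma) |  (value at s = sigma is
   irrelevant: a null set) *)
Definition Kker (s sigma : R) : R :=
  ln `| sin (s + sigma) / sin (s - sigma) |.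

Definition Hop (w : R -> R) (sigma : R) : R :=
  pi^-1 * Rintegral mu I0 (fun s => Kker s sigma * w s).

Definition Phi (alpha : R) (zeta : R -> R) (sigma : R) : R :=
  3 / (alpha * pi) *
  (sin (sigma + (Hop zeta sigma) / 3) * (cos sigma / sin sigma))
  / expR (Rintegral mu `[0, sigma] zeta).

Definition nonneg_solution (alpha : R) (zeta : R -> R) : Prop :=
  [/\ inL2 zeta,
      {ae mu, forall x, I0 x -> 0 <= zeta x} &
      {ae mu, forall x, I0 x -> zeta x = Phi alpha zeta x}].

End Defs.

(* Main.v *)
(**
Put [r := sqrt tan].  In the variable [x = tan s] the kernel is
[ln |(x + y) / (x - y)|], homogeneous of degree 0, and
  [int_0^oo ln |(x + y) / (x - y)| x^(-1/2) dx = 2 pi y^(1/2)],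
the primitive being elementary after [x = y u^2].  Hence, for the kernel
[K / (3 pi) + 1_{s < t}] and the weights [1 / r(s)], [r(t)], Schur's test bounds
[h |-> cot t * int (K / (3 pi) + 1_{s < t}) h ds] on [L^2] by [2/3 + 2 = 8/3].
On non-negative functions [sin] and [exp (- .)] are 1-Lipschitz, so
[|Phi v - Phi w|] is at most [3 / (alpha pi)] times this operator applied to
[|v - w|]: [Phi] is Lipschitz in [L^2] with constant [8 / (alpha pi) < 1], whence
uniqueness.

For existence, the same weighted integral bounds show that [Phi] preserves
[0 <= z <= 1 / (2 r)] and contracts the norm [sup r |z|] by [8 / (alpha pi)], so
its iterates from 0 converge pointwise to a fixed point; it is in [L^2] by Fatou,
because the Schur bound 2/3 for [K / (3 pi)] alone keeps the [L^2] norm of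
the iterates below 1.
*)
Require Import Defs.
From HB Require Import structures.
From mathcomp Require Import all_boot all_order all_algebra.
From mathcomp Require Import all_classical all_reals all_analysis.
From mathcomp Require Import measurable_realfun ring lra.
Import Order.TTheory GRing.Theory Num.Theory.
Import numFieldNormedType.Exports.
Local Open Scope classical_set_scope.
Local Open Scope ring_scope.
Set Implicit Arguments. Unset Strict Implicit. Unset Printing Implicit Defensive.

(** * The primitive of the logarithmic kernel *)

(** Since dx = (1 + tan^2) ds, the elementary integral carries a factor [1 + tan s ^+ 2] that the
    Schur integrals lack. Bounding 1 by this factor only enlarges them, so upper bounds suffice and
    no exact value of an improper integral is needed. As cot t is [(rtan t ^+ 2)^-1], the transposed
    half of Schur's test integrates in t against [(rtan t ^+ 3)^-1]. The change x -> 1/x turns it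
    into the first half, with the same constant, so the same primitive serves with the quotient of
    the roots inverted. The integrals inside [Phi] are extended-real integrals under [fine], hence 0
    when infinite. The estimates therefore live in the extended reals, and finiteness has to be
    supplied: almost everywhere from the L^2 norm for uniqueness, everywhere from the bound 1 / (2
    r) for existence. That bound has square cot / 4, not integrable at 0, so it alone does not put
    the fixed point in L^2. Completeness of L^2 is never invoked. *)

Section calculus.
Variable R : realType.
Implicit Types (a b u x : R) (f df : R -> R).

Lemma is_derive_nondecreasing f df a b : a <= b ->
  (forall x, a <= x <= b -> is_derive x 1 f (df x)) ->
  (forall x, a <= x <= b -> 0 <= df x) -> f a <= f b.
Proof.
move=> ab fdf df0.
have [||c] := @MVT_segment R f df a b ab.
- by move=> x; rewrite in_itv/= => /andP[ax xb]; apply: fdf; rewrite !ltW.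
- apply: derivable_within_continuous => x; rewrite in_itv/= => /fdf [].
  by [].
rewrite in_itv/= => /df0 dfc fE.
by rewrite -subr_ge0 fE mulr_ge0// subr_ge0.
Qed.

Lemma is_derive1_ln_norm x : x != 0 -> is_derive x 1 (fun y => ln `|y|) x^-1.
Proof.
move=> x0; have [xp|] := ltP 0 x; last rewrite le_eqVlt (negbTE x0)/= => xn.
- apply: near_eq_is_derive (is_derive1_ln xp).
  near=> y; rewrite gtr0_norm//; near: y; exact: lt_nbhsr.
- have : is_derive x 1 (@ln R \o -%R) ((-x)^-1 * -1).
    by apply: is_derive1_comp; apply: is_derive1_ln; rewrite oppr_gt0.
  rewrite invrN mulrN1 opprK; apply: near_eq_is_derive.
  near=> y; rewrite ltr0_norm//=; near: y; exact: lt_nbhsl.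
Unshelve. all: by end_near. Qed.

(* [lograt] is [ln |(1 + u^2) / (1 - u^2)|] and [logint] its primitive vanishing at 0. *)
Definition lograt u := ln (1 + u ^+ 2) - ln `|1 - u| - ln `|1 + u|.

Lemma is_derive_lnD1 u : 1 + u != 0 ->
  is_derive u 1 (fun y => ln `|1 + y|) (1 + u)^-1.
Proof.
move=> u1; rewrite -[(1 + u)^-1]mulr1.
apply: (@is_derive1_comp R (fun y => ln `|y|) (fun y => 1 + y) u).
  exact: is_derive1_ln_norm.
by apply: is_derive_eq; ring.
Qed.

Lemma is_derive_ln1B u : 1 - u != 0 ->
  is_derive u 1 (fun y => ln `|1 - y|) (- (1 - u)^-1).
Proof.
move=> u1; rewrite -mulrN1.
apply: (@is_derive1_comp R (fun y => ln `|y|) (fun y => 1 - y) u).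
  exact: is_derive1_ln_norm.
by apply: is_derive_eq; ring.
Qed.

Lemma is_derive_lnD1sqr u :
  is_derive u 1 (fun y => ln (1 + y ^+ 2)) ((1 + u ^+ 2)^-1 * (2 * u)).
Proof.
apply: (@is_derive1_comp R (@ln R) (fun y => 1 + y ^+ 2) u).
  by apply: is_derive1_ln; rewrite ltr_wpDr// sqr_ge0.
by apply: is_derive_eq; rewrite /GRing.scale/=; ring.
Qed.

Lemma derivable_lograt u : 0 <= u -> u != 1 -> derivable lograt u 1.
Proof.
move=> u0 u1.
have n1 : 1 - u != 0 by rewrite subr_eq0 eq_sym.
have n2 : 1 + u != 0 by rewrite gt_eqF// ltr_wpDr.
have d1 := is_derive_ln1B n1; have d2 := is_derive_lnD1 n2.
have d3 := is_derive_lnD1sqr u.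
exact: ex_derive.
Qed.

Definition logint u := u * lograt u + 2 * atan u - ln `|1 + u| + ln `|1 - u|.

Lemma is_derive_logint u : 0 <= u -> u != 1 ->
  is_derive u 1 logint (lograt u).
Proof.
move=> u0 u1.
have n1 : 1 - u != 0 by rewrite subr_eq0 eq_sym.
have n2 : 1 + u != 0 by rewrite gt_eqF// ltr_wpDr.
have n3 : 0 < 1 + u ^+ 2 by rewrite ltr_wpDr// sqr_ge0.
have d1 := is_derive_ln1B n1; have d2 := is_derive_lnD1 n2.
have d3 := is_derive_lnD1sqr u.
rewrite /logint /lograt; apply: is_derive_eq; rewrite /GRing.scale/=.
by field; rewrite n1 n2 gt_eqF.
Qed.

Lemma lograt_ge0 u : 0 <= u -> u != 1 -> 0 <= lograt u.
Proof.
move=> u0 u1.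
have n1 : 1 - u != 0 by rewrite subr_eq0 eq_sym.
have n2 : 1 + u != 0 by rewrite gt_eqF// ltr_wpDr.
have n3 : 0 < 1 + u ^+ 2 by rewrite ltr_wpDr// sqr_ge0.
rewrite /lograt -addrA -opprD subr_ge0 -lnM ?posrE ?normr_gt0//.
rewrite -normrM ler_ln ?posrE ?normr_gt0 ?mulf_neq0//.
by have := sqr_ge0 u; case: (ger0P ((1 - u) * (1 + u))); nra.
Qed.

(* The part of [logint] that is smooth at the singularity [u = 1]. *)
Definition logrem u := u * ln (1 + u ^+ 2) + 2 * atan u - (1 + u) * ln (1 + u).

(** The singular term (u - 1) ln |1 - u| is positive for 0 < u < 1 and negative for 1 < u < 2. So
    [logrem] bounds [logint] from above left of the singularity and from below just right of it, and
    no limit at 1 has to be taken. *)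
Lemma logintE u : 0 <= u ->
  logint u = logrem u - (u - 1) * ln `|1 - u|.
Proof.
by move=> u0; rewrite /logint /lograt /logrem (ger0_norm (addr_ge0 ler01 u0)); ring.
Qed.

Lemma logrem1 : logrem 1 = pi / 2 - ln 2.
Proof.
by rewrite /logrem atan1 expr1n -[1 + 1]/(2 : R); field.
Qed.

(** The derivative is 1 - ln y with y = (1 + x) / (1 + x^2) <= 2, and ln y <= y - 1 <= 1. *)
Lemma logrem_nondecreasing u v : 0 <= u -> u <= v -> logrem u <= logrem v.
Proof.
move=> u0 uv.
apply: (@is_derive_nondecreasing logrem (fun x => 1 + ln (1 + x ^+ 2) - ln (1 + x))) => //.
- move=> x /andP[ux _].
  have x0 : 0 <= x by exact: le_trans ux.
  have n2 : 0 < 1 + x by rewrite ltr_wpDr.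
  have n3 : 0 < 1 + x ^+ 2 by rewrite ltr_wpDr// sqr_ge0.
  have d2 : is_derive x 1 (fun y => ln (1 + y)) ((1 + x)^-1).
    apply: near_eq_is_derive (is_derive_lnD1 (lt0r_neq0 n2)).
    near=> y; rewrite gtr0_norm// -ltrBlDl sub0r; near: y; apply: lt_nbhsr; lra.
  have d3 := is_derive_lnD1sqr x.
  rewrite /logrem; apply: is_derive_eq; rewrite /GRing.scale/=.
  by field; rewrite !gt_eqF.
- move=> x /andP[ux _].
  have x0 : 0 <= x by exact: le_trans ux.
  have n2 : 0 < 1 + x by rewrite ltr_wpDr.
  have n3 : 0 < 1 + x ^+ 2 by rewrite ltr_wpDr// sqr_ge0.
  have : ln ((1 + x) / (1 + x ^+ 2)) <= (1 + x) / (1 + x ^+ 2) - 1.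
    have := @le_ln1Dx R ((1 + x) / (1 + x ^+ 2) - 1).
    rewrite addrCA subrr addr0; apply.
    by rewrite ltrBrDr addrC subrr divr_gt0.
  rewrite ln_div ?posrE//.
  have : (1 + x) / (1 + x ^+ 2) <= 2.
    rewrite ler_pdivrMr//; have := sqr_ge0 (x - 1); have := sqr_ge0 x; nra.
  lra.
Unshelve. all: by end_near. Qed.

Lemma logint_nondecreasing_in u v : 0 <= u -> u <= v -> v < 1 \/ 1 < u ->
  logint u <= logint v.
Proof.
move=> u0 uv uv1.
have uvE x : u <= x <= v -> 0 <= x /\ x != 1.
  move=> /andP[ux xv]; split; first exact: le_trans ux.
  by apply/eqP => x1; case: uv1; rewrite ltNge -x1 ?ux ?xv.
apply: (@is_derive_nondecreasing logint lograt) => // x /uvE[x0 x1].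
  exact: is_derive_logint.
exact: lograt_ge0.
Qed.

(** The constant is [logrem 1], the common limit of [logint] on both sides of 1. It cancels when the
    contributions of s < t and s > t are added, which leaves [pi]. *)
Lemma logint_lt1 u : 0 <= u < 1 -> 0 <= logint u <= pi / 2 - ln 2.
Proof.
move=> /andP[u0 u1]; apply/andP; split.
  have := @logint_nondecreasing_in 0 u (lexx _) u0 (or_introl u1).
  rewrite [logint 0](_ : _ = 0)//.
  by rewrite /logint /lograt atan0 expr0n/= !(subr0, addr0, normr1, ln1, mul0r, mulr0).
rewrite logintE// -logrem1.
have := @logrem_nondecreasing u 1 u0 (ltW u1).
have : ln `|1 - u| <= 0 by apply: ln_le0; rewrite ger0_norm; lra.
by nra.
Qed.

Lemma logint_gt1 u : 1 < u -> pi / 2 - ln 2 <= logint u <= pi.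
Proof.
move=> u1; have u0 : 0 <= u by lra.
apply/andP; split.
  have le2 v : 1 < v <= 2 -> pi / 2 - ln 2 <= logint v.
    move=> /andP[v1 v2]; rewrite -logrem1 logintE; last lra.
    have := @logrem_nondecreasing 1 v ler01 (ltW v1).
    have : ln `|1 - v| <= 0 by apply: ln_le0; rewrite ler0_norm; lra.
    by nra.
  (* Beyond 2 the singular term has the wrong sign, and monotonicity from 2 takes over. *)
  have [u2|/ltW u2] := leP u 2; first by apply: le2; rewrite u1.
  apply: (le_trans (le2 2 _)); first lra.
  by apply: logint_nondecreasing_in => //; right; lra.
apply/ler_addgt0Pr => e e0.
(* By monotonicity the bound may be proved far out: [lograt v] is at most 2 / (v^2 - 1), and this
   choice of v makes [v * lograt v] at most e. The arctangent contributes at most [pi] and the other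
   logarithms a non-positive amount. *)
pose v := Num.max u (Num.max 2 (4 / e)).
have uv : u <= v by rewrite le_max lexx.
have v2 : 2 <= v by rewrite !le_max lexx orbT.
have ve : 4 <= v * e by rewrite -ler_pdivrMr// !le_max lexx !orbT.
have v0 : 0 <= v by lra.
apply: (@le_trans _ _ (logint v)).
  by apply: logint_nondecreasing_in => //; right.
rewrite /logint /lograt.
have n1 : 0 < v - 1 by lra.
have n2 : 0 < 1 + v by lra.
have n3 : 0 < 1 + v ^+ 2 by nra.
have := atan_ltpi2 v.
rewrite distrC gtr0_norm// gtr0_norm//.
have h1 : ln (v - 1) <= ln (1 + v) by rewrite ler_ln ?posrE//; lra.
have h2 : v * (ln (1 + v ^+ 2) - ln (v - 1) - ln (1 + v)) <= e.
  have n4 : 0 < (v - 1) * (1 + v) by exact: mulr_gt0.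
  have : ln ((1 + v ^+ 2) / ((v - 1) * (1 + v))) <= 2 / ((v - 1) * (1 + v)).
    have := @le_ln1Dx R (2 / ((v - 1) * (1 + v))).
    rewrite (_ : 1 + 2 / _ = (1 + v ^+ 2) / ((v - 1) * (1 + v))); last first.
      by field; rewrite !gt_eqF.
    by apply; rewrite (@lt_le_trans _ _ 0)// divr_ge0// ltW.
  rewrite ln_div ?posrE// lnM ?posrE// opprD addrA.
  move=> /(ler_wpM2l v0) /le_trans; apply.
  rewrite mulrA ler_pdivrMr//; nra.
lra.
Qed.
End calculus.

(** * Improper integrals through bounded primitives *)

Section open_interval.
Variable R : realType.
Notation mu := (@lebesgue_measure R).
Implicit Types (a b m M s t x : R) (f F : R -> R).

(** Monotone convergence along closed subintervals, with the fundamental theorem of calculus on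
    each. Only bounds on the primitive are asked, so its limits at the endpoints, where the
    integrand may be singular, never enter. *)
Lemma integral_oo_le f F a b m M : a < b ->
  (forall x, a < x < b -> is_derive x 1 F (f x)) ->
  (forall x, a < x < b -> derivable f x 1) ->
  (forall x, a < x < b -> 0 <= f x) ->
  (forall x, a < x < b -> m <= F x <= M) ->
  (\int[mu]_(x in `]a, b[) (f x)%:E <= (M - m)%:E)%E.
Proof.
move=> ab dF df f0 mFM.
(* Starting at 3 keeps the margin at most a third of the length, so every closed subinterval is
   nondegenerate. *)
pose e (n : nat) := (b - a) / n.+3%:R.
have e0 n : 0 < e n by rewrite divr_gt0// subr_gt0.
have e3 n : e n <= (b - a) / 3.
  by rewrite ler_pM2l ?subr_gt0// lef_pV2 ?posrE// ler_nat.
have abn n : a + e n < b - e n by have := e3 n; lra.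
pose A n := `[a + e n, b - e n]%classic : set R.
have Aab n x : A n x -> a < x < b.
  by rewrite /A /= in_itv/= => /andP[]; have := e0 n; lra.
have UA : \bigcup_n A n = `]a, b[%classic.
  apply/seteqP; split => [x [n _ /Aab]|x]; first by rewrite /= in_itv.
  rewrite /= in_itv/= => /andP[ax xb].
  pose d := Num.min (x - a) (b - x).
  have d0 : 0 < d by rewrite lt_min !subr_gt0 ax.
  have [n nd] : exists n : nat, (b - a) / d <= n%:R.
    by exists (Num.bound ((b - a) / d)); rewrite ltW// archi_boundP// divr_ge0// ?ltW// subr_gt0.
  have : e n <= d.
    rewrite ler_pdivrMr// mulrC -ler_pdivrMr// (le_trans nd)// ler_nat.
    by rewrite -addn3 leq_addr.
  rewrite le_min => /andP[] *; exists n => //; rewrite /A /= in_itv/=; lra.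
have cf x : a < x < b -> {for x, continuous f}.
  by move=> /df; rewrite derivable1_diffP; exact: differentiable_continuous.
have mf n : measurable_fun (A n) f.
  apply: subspace_continuous_measurable_fun; first exact: measurable_itv.
  by apply: continuous_in_subspaceT => x; rewrite inE => /Aab /cf.
have : (\int[mu]_(x in A n) (f x)%:E)%E @[n --> \oo] -->
    (\int[mu]_(x in \bigcup_n A n) (f x)%:E)%E.
  apply: ge0_nondecreasing_set_cvg_integral.
  - move=> n k nk; apply/subsetPset => x; rewrite /A/= !in_itv/=.
    have : e k <= e n by rewrite ler_pM2l ?subr_gt0// lef_pV2 ?posrE// ler_nat.
    by move=> ? /andP[? ?]; apply/andP; lra.
  - by move=> n; exact: measurable_itv.
  - move=> n; apply/measurable_EFinP; exact: mf.
  - by move=> n x /Aab /f0; rewrite lee_fin.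
rewrite UA; apply: cvge_le.
near=> n; rewrite /= (@continuous_FTC2 R f F (a + e n) (b - e n))//.
- rewrite -EFinB lee_fin.
  have := mFM (a + e n); have := mFM (b - e n); have := e0 n; have := abn n; lra.
- by apply: continuous_in_subspaceT => x; rewrite inE => /Aab /cf.
- have cF x : a < x < b -> {for x, continuous F}.
    by move=> /dF [+ _]; rewrite derivable1_diffP; exact: differentiable_continuous.
  split.
  + move=> x xab; have [] // : is_derive x 1 F (f x).
    by apply/dF/(Aab n)/subset_itv_oo_cc.
  + by apply: cvg_at_right_filter; apply: cF; have := e0 n; have := abn n; lra.
  + by apply: cvg_at_left_filter; apply: cF; have := e0 n; have := abn n; lra.
- move=> x xab; rewrite derive1E; apply: derive_val.
  by apply/dF/(Aab n)/subset_itv_oo_cc.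
Unshelve. all: by end_near. Qed.
End open_interval.

(** * The kernel in terms of the square root of the tangent *)

Section kernel.
Variable R : realType.
Notation mu := (@lebesgue_measure R).
Implicit Types (a b s t x : R).

Definition rtan s := Num.sqrt (tan s).

Lemma I0E s : I0 s = (0 < s < pi / 2) :> Prop.
Proof. by rewrite /I0/= in_itv. Qed.

Lemma sin_cos_gt0 s : I0 s -> 0 < sin s /\ 0 < cos s.
Proof.
rewrite I0E => s0; split; first exact: sin_gt0_pihalf.
by apply: cos_gt0_pihalf; have := pi_gt0 R; lra.
Qed.

Lemma tan_gt0 s : I0 s -> 0 < tan s.
Proof. by case/sin_cos_gt0 => ? ?; rewrite divr_gt0. Qed.

Lemma rtan_gt0 s : I0 s -> 0 < rtan s.
Proof. by move=> /tan_gt0; rewrite sqrtr_gt0. Qed.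

Lemma sqr_rtan s : I0 s -> rtan s ^+ 2 = tan s.
Proof. by move=> /tan_gt0 /ltW /sqr_sqrtr. Qed.

Lemma lt_rtan s t : I0 s -> I0 t -> s < t -> rtan s < rtan t.
Proof.
move=> s0 t0 st; rewrite ltr_sqrt ?tan_gt0// ltr_tan// in_itv/=.
  by move: s0; rewrite I0E; lra.
by move: t0; rewrite I0E; lra.
Qed.

Lemma rtan_eq s t : I0 s -> I0 t -> s != t -> rtan s != rtan t.
Proof.
move=> s0 t0; case: ltgtP => // [/lt_rtan|/lt_rtan] h _.
  by rewrite lt_eqF// h.
by rewrite gt_eqF// h.
Qed.

Lemma is_derive_rtan s : I0 s ->
  is_derive s 1 rtan ((1 + tan s ^+ 2) / (2 * rtan s)).
Proof.
move=> s0; have [_ c0] := sin_cos_gt0 s0.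
have := @is_derive1_comp R (@Num.sqrt R) (@tan R) s _ _ (is_derive1_sqrt (tan_gt0 s0)) (is_derive_tan (lt0r_neq0 c0)).
by rewrite cos2_tan2 ?gt_eqF// mulrC.
Qed.

Lemma KkerC s t : Kker s t = Kker t s.
Proof. by rewrite /Kker !normrM addrC !normfV -(normrN (sin (s - t))) -sinN opprB. Qed.

Lemma Kker_diag s : Kker s s = 0.
Proof. by rewrite /Kker subrr sin0 invr0 mulr0 normr0 ln0. Qed.

Lemma rtan_div_neq1 s t : I0 s -> I0 t -> s != t -> rtan s / rtan t != 1.
Proof.
move=> s0 t0 st; apply/eqP => /(congr1 (fun z => z * rtan t)).
rewrite mul1r divfK ?gt_eqF ?rtan_gt0// => /eqP; apply/negP; exact: rtan_eq.
Qed.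

(** Dividing both sines by cos s cos t leaves (tan s + tan t) / (tan s - tan t), a function of tan s
    / tan t, which is the square of the quotient of roots. *)
Lemma KkerE s t : I0 s -> I0 t -> s != t -> Kker s t = lograt (rtan s / rtan t).
Proof.
rewrite /lograt => s0 t0 st.
have [ss cs] := sin_cos_gt0 s0; have [sst ct] := sin_cos_gt0 t0.
have pt := rtan_gt0 t0; have ps := rtan_gt0 s0.
set u := _ / _.
have u0 : 0 < u by exact: divr_gt0.
have u1 : 1 - u != 0 by rewrite subr_eq0 eq_sym; exact: rtan_div_neq1.
have n1 : 1 + u != 0 by rewrite gt_eqF//; lra.
have tt := tan_gt0 t0.
have xE : tan s = u ^+ 2 * tan t.
  by rewrite -(sqr_rtan s0) -(sqr_rtan t0) expr_div_n divfK// gt_eqF// exprn_gt0.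
rewrite /Kker.
have -> : sin (s + t) / sin (s - t) = - ((1 + u ^+ 2) / ((1 - u) * (1 + u))).
  have sE : sin s = u ^+ 2 * tan t * cos s by rewrite -xE divfK// gt_eqF.
  have tE : sin t = tan t * cos t by rewrite divfK// gt_eqF.
  rewrite sinD sinB sE tE.
  have -> : u ^+ 2 * tan t * cos s * cos t - cos s * (tan t * cos t) =
    - (tan t * cos s * cos t * ((1 - u) * (1 + u))) by ring.
  by field; rewrite u1 n1 !(gt_eqF cs) !(gt_eqF ct) !(gt_eqF tt).
rewrite normrN normrM normfV normrM ln_div ?posrE ?mulr_gt0 ?normr_gt0//.
  rewrite lnM ?posrE ?normr_gt0// ?opprD ?addrA.
  by rewrite (gtr0_norm (_ : 0 < 1 + u ^+ 2))//; nra.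
by rewrite gt_eqF//; nra.
Qed.

Lemma Kker_ge0 s t : I0 s -> I0 t -> 0 <= Kker s t.
Proof.
move=> s0 t0; have [->|st] := eqVneq s t; first by rewrite Kker_diag.
by rewrite KkerE// lograt_ge0 ?rtan_div_neq1// divr_ge0 ?ltW ?rtan_gt0.
Qed.

(** The formula x exp(- ln x^2) is built from measurable functions on the whole line; its factor x
    also reproduces the default value 0 at 0. *)
Lemma measurable_inv : measurable_fun [set: R] (fun x => x^-1).
Proof.
have -> : (fun x => x^-1) = (fun x => x * expR (- ln (x ^+ 2))).
  apply/funext => x; have [->|x0] := eqVneq x 0; first by rewrite mul0r invr0.
  by rewrite expRN lnK ?posrE ?exprn_even_gt0// expr2 invfM mulrA divff// mul1r.
apply: measurable_funM => //; apply: measurableT_comp; first exact: measurable_expR.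
by apply: measurableT_comp => //; apply: measurableT_comp; first exact: measurable_ln.
Qed.

Lemma measurable_tan : measurable_fun [set: R] (@tan R).
Proof.
apply: measurable_funM.
  by apply: continuous_measurable_fun; exact: continuous_sin.
apply: (measurableT_comp measurable_inv).
by apply: continuous_measurable_fun; exact: continuous_cos.
Qed.

Lemma measurable_rtan : measurable_fun [set: R] rtan.
Proof.
apply: (@measurableT_comp _ _ _ _ _ _ (@Num.sqrt R)); last exact: measurable_tan.
by apply: continuous_measurable_fun; exact: sqrt_continuous.
Qed.

Lemma measurable_Kker : measurable_fun [set: R * R] (fun z => Kker z.1 z.2).
Proof.
have ms : measurable_fun [set: R] (@sin R).
  by apply: continuous_measurable_fun; exact: continuous_sin.
apply: (measurableT_comp (@measurable_ln R)).
apply: measurableT_comp => //; apply: measurable_funM.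
  by apply: (measurableT_comp ms); exact: measurable_funD.
apply: (measurableT_comp measurable_inv).
by apply: (measurableT_comp ms); exact: measurable_funB.
Qed.

End kernel.

(** * The two homogeneous integrals of the kernel *)

Section kernel_integrals.
Variable R : realType.
Notation mu := (@lebesgue_measure R).
Implicit Types (a b m M s t x : R) (f : R -> R).

Lemma sub_I0 a b s : 0 <= a -> b <= pi / 2 -> a < s < b -> I0 s.
Proof. by move=> ? ?; rewrite I0E; lra. Qed.

Lemma derivable_expr f n x : derivable f x 1 -> derivable (fun y => f y ^+ n) x 1.
Proof.
move=> /derivable1_diffP df; apply/derivable1_diffP.
apply: (@differentiable_comp _ _ _ _ f (@GRing.exp R ^~ n)) => //.
exact/derivable1_diffP/exprn_derivable.
Qed.

Lemma derivable_weight n s : I0 s ->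
  derivable (fun x => (1 + tan x ^+ 2) / rtan x ^+ n : R) s 1.
Proof.
move=> s0; have [_ c0] := sin_cos_gt0 s0.
have dt : derivable (@tan R) s 1 by apply: derivable_tan; rewrite gt_eqF.
have [dr _] := is_derive_rtan s0.
have pn : rtan s ^+ n != 0 by rewrite expf_neq0// gt_eqF// rtan_gt0.
apply: derivableM.
  apply: derivableD; first exact: derivable_cst.
  exact: derivable_expr.
apply: derivableV; first exact: pn.
exact: derivable_expr.
Qed.

(** In s, [2 * rtan t * logint (rtan s / rtan t)] is a primitive of the integrand. Keeping t out of
    the interval keeps the quotient away from the singular value 1. *)
Lemma integral_oo_Kker_invr a b t m M : 0 <= a -> a < b -> b <= pi / 2 ->
  I0 t -> ~~ (a < t < b) ->
  (forall s, a < s < b -> m <= logint (rtan s / rtan t) <= M) ->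
  (\int[mu]_(s in `]a, b[) (Kker s t * ((1 + tan s ^+ 2) / rtan s))%:E <=
     (2 * rtan t * (M - m))%:E)%E.
Proof.
move=> a0 ab bp t0 tab mM.
have pt := rtan_gt0 t0.
have st s : a < s < b -> s != t by apply: contraTneq => ->.
have abI s : a < s < b -> I0 s by exact: sub_I0.
have ds s : a < s < b -> is_derive s 1 (fun x => rtan x / rtan t)
    ((1 + tan s ^+ 2) / (2 * rtan s) / rtan t).
  move=> /abI/is_derive_rtan ?; apply: is_derive_eq.
  by rewrite /GRing.scale/=; ring.
rewrite [leLHS](_ : _ = \int[mu]_(s in `]a, b[)
    (lograt (rtan s / rtan t) * ((1 + tan s ^+ 2) / rtan s))%:E)%E; last first.
  apply: eq_integral => s; rewrite inE/= in_itv/= => sab; by have s0 := abI _ sab; have sn := st _ sab; rewrite KkerE.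
rewrite (_ : 2 * rtan t * (M - m) = 2 * rtan t * M - 2 * rtan t * m); last by ring.
apply: (@integral_oo_le R
    (fun s => lograt (rtan s / rtan t) * ((1 + tan s ^+ 2) / rtan s))
    (fun s => 2 * rtan t * logint (rtan s / rtan t))).
  exact: ab.
1-4: move=> s sab.
- have s0 := abI _ sab; have ps := rtan_gt0 s0.
  have d : is_derive s 1 (fun x => logint (rtan x / rtan t)) (lograt (rtan s / rtan t) *
      ((1 + tan s ^+ 2) / (2 * rtan s) / rtan t)).
    apply: (@is_derive1_comp R (@logint R) (fun x => rtan x / rtan t)).
      apply: is_derive_logint; first by rewrite divr_ge0// ltW.
      by rewrite rtan_div_neq1// st.
    exact: ds.
  apply: is_derive_eq; rewrite /GRing.scale/=.
  by field; rewrite !gt_eqF.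
- have s0 := abI _ sab; have ps := rtan_gt0 s0.
  apply: (@derivableM _ _ (fun x => lograt (rtan x / rtan t)) (fun x => (1 + tan x ^+ 2) / rtan x)); last first.
    exact: (@derivable_weight 1 s s0).
  apply/derivable1_diffP/differentiable_comp.
    by apply/derivable1_diffP; have [] := ds _ sab.
  apply/derivable1_diffP/derivable_lograt; first by rewrite divr_ge0// ltW.
  by rewrite rtan_div_neq1// st.
- have s0 := abI _ sab; have ps := rtan_gt0 s0.
  rewrite mulr_ge0//.
    by rewrite lograt_ge0 ?rtan_div_neq1 ?st// divr_ge0// ltW.
  by rewrite divr_ge0 ?ltW// ltr_wpDr// sqr_ge0.
- have /andP[? ?] := mM _ sab.
  by rewrite !ler_pM2l ?mulr_gt0//; exact: mM.
Qed.

(** By symmetry of the kernel the quotient may be inverted; a primitive is then [- (2 / rtan t *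
    logint (rtan t / rtan s))]. *)
Lemma integral_oo_Kker_invr3 a b t m M : 0 <= a -> a < b -> b <= pi / 2 ->
  I0 t -> ~~ (a < t < b) ->
  (forall s, a < s < b -> m <= logint (rtan t / rtan s) <= M) ->
  (\int[mu]_(s in `]a, b[) (Kker s t * ((1 + tan s ^+ 2) / rtan s ^+ 3))%:E <=
     (2 / rtan t * (M - m))%:E)%E.
Proof.
move=> a0 ab bp t0 tab mM.
have pt := rtan_gt0 t0.
have st s : a < s < b -> s != t by apply: contraTneq => ->.
have abI s : a < s < b -> I0 s by exact: sub_I0.
have ds s : a < s < b -> is_derive s 1 (fun x => rtan t / rtan x)
    (- (rtan t * (1 + tan s ^+ 2) / (2 * rtan s ^+ 3))).
  move=> /abI s0; have ps := rtan_gt0 s0; have pn := lt0r_neq0 ps.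
  have d := is_derive_rtan s0.
  apply: is_derive_eq; rewrite /GRing.scale/=.
  by field; rewrite pn.
rewrite [leLHS](_ : _ = \int[mu]_(s in `]a, b[)
    (lograt (rtan t / rtan s) * ((1 + tan s ^+ 2) / rtan s ^+ 3))%:E)%E; last first.
  apply: eq_integral => s; rewrite inE/= in_itv/= => sab.
  by have s0 := abI _ sab; have := st _ sab; rewrite eq_sym KkerC => sn; rewrite KkerE.
have -> : 2 / rtan t * (M - m) = - (2 / rtan t * m) - - (2 / rtan t * M) by ring.
apply: (@integral_oo_le R
    (fun s => lograt (rtan t / rtan s) * ((1 + tan s ^+ 2) / rtan s ^+ 3))
    (fun s => - (2 / rtan t * logint (rtan t / rtan s)))).
  exact: ab.
1-4: move=> s sab.
- have s0 := abI _ sab; have ps := rtan_gt0 s0.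
  have d : is_derive s 1 (fun x => logint (rtan t / rtan x)) (lograt (rtan t / rtan s) *
      (- (rtan t * (1 + tan s ^+ 2) / (2 * rtan s ^+ 3)))).
    apply: (@is_derive1_comp R (@logint R) (fun x => rtan t / rtan x)).
      apply: is_derive_logint; first by rewrite divr_ge0// ltW.
      by rewrite rtan_div_neq1// eq_sym st.
    exact: ds.
  apply: is_derive_eq; rewrite /GRing.scale/=.
  by field; rewrite !gt_eqF.
- have s0 := abI _ sab; have ps := rtan_gt0 s0.
  apply: (@derivableM _ _ (fun x => lograt (rtan t / rtan x)) (fun x => (1 + tan x ^+ 2) / rtan x ^+ 3)); last first.
    exact: (@derivable_weight 3 s s0).
  apply/derivable1_diffP/differentiable_comp.
    by apply/derivable1_diffP; have [] := ds _ sab.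
  apply/derivable1_diffP/derivable_lograt; first by rewrite divr_ge0// ltW.
  by rewrite rtan_div_neq1// eq_sym st.
- have s0 := abI _ sab; have ps := rtan_gt0 s0.
  rewrite mulr_ge0//.
    by rewrite lograt_ge0 ?rtan_div_neq1// ?divr_ge0 1?eq_sym ?st// ltW.
  by rewrite divr_ge0 ?exprn_ge0 ?ltW// ltr_wpDr// sqr_ge0.
- have /andP[? ?] := mM _ sab.
  by rewrite !lerN2 !ler_pM2l ?divr_gt0//; apply/andP.
Qed.

Lemma ge0_integral_I0_split t f : I0 t -> measurable_fun setT f ->
  (forall s, I0 s -> 0 <= f s) ->
  (\int[mu]_(s in @I0 R) (f s)%:E =
   \int[mu]_(s in `]0%R, t[) (f s)%:E + \int[mu]_(s in `]t, (pi / 2)%R[) (f s)%:E)%E.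
Proof.
move=> t0 mf f0.
have mfE (D : set R) : measurable_fun D (EFin \o f).
  by apply/measurable_EFinP; exact: measurable_funTS.
have I0U : @I0 R = (`]0%R, t] `|` `]t, (pi / 2)%R[)%classic.
  by rewrite -itv_bndbnd_setU//; move: t0; rewrite I0E bnd_simp; lra.
rewrite {1}I0U ge0_integral_setU//=.
- by rewrite -integral_itv_bndo_bndc//; exact: mfE.
- exact: mfE.
- by move=> x xI; rewrite lee_fin; apply: f0; rewrite I0U.
- apply/eqP; rewrite -subset0 => x []; rewrite /= !in_itv/=; lra.
Qed.

Lemma measurable_Kker1 t : measurable_fun [set: R] (fun s => Kker s t).
Proof.
have mp : measurable_fun [set: R] (fun s => (s, t)) by exact: measurable_fun_pair.
exact: (measurableT_comp (@measurable_Kker R) mp).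
Qed.

Lemma rtan_div_lt1 s t : I0 s -> I0 t -> s < t -> 0 <= rtan s / rtan t < 1.
Proof.
move=> s0 t0 st; rewrite divr_ge0 ?ltW ?rtan_gt0//=.
by rewrite ltr_pdivrMr ?rtan_gt0// mul1r lt_rtan.
Qed.

Lemma rtan_div_gt1 s t : I0 s -> I0 t -> t < s -> 1 < rtan s / rtan t.
Proof. by move=> s0 t0 st; rewrite ltr_pdivlMr ?rtan_gt0// mul1r lt_rtan. Qed.

Lemma measurable_weight n : measurable_fun [set: R] (fun s => (1 + tan s ^+ 2) / rtan s ^+ n).
Proof.
apply: measurable_funM.
  by apply: measurable_funD => //; apply: measurable_funX; exact: measurable_tan.
apply: (measurableT_comp (@measurable_inv R)).
by apply: measurable_funX; exact: measurable_rtan.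
Qed.

Lemma integral_Kker_invr t : I0 t ->
  (\int[mu]_(s in @I0 R) (Kker s t * ((1 + tan s ^+ 2) / rtan s))%:E <=
     (2 * pi * rtan t)%:E)%E.
Proof.
move=> t0; have /andP[t1 t2] : 0 < t < pi / 2 by rewrite -I0E.
rewrite (@ge0_integral_I0_split t)//; last 2 first.
- by apply: measurable_funM; [exact: measurable_Kker1|exact: (measurable_weight 1)].
- move=> s s0; rewrite mulr_ge0 ?Kker_ge0// divr_ge0 ?ltW ?rtan_gt0//.
  by rewrite ltr_wpDr// sqr_ge0.
have -> : 2 * pi * rtan t = 2 * rtan t * (pi / 2 - ln 2 - 0) +
    2 * rtan t * (pi - (pi / 2 - ln 2)) by field.
rewrite EFinD; apply: leeD; apply: integral_oo_Kker_invr => //; rewrite ?ltxx ?andbF//.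
- exact: ltW.
- move=> s /andP[s0 st]; apply: logint_lt1; apply: rtan_div_lt1 => //.
  by rewrite I0E; lra.
- exact: ltW.
- move=> s /andP[s0 st]; apply: logint_gt1; apply: rtan_div_gt1 => //.
  by rewrite I0E; lra.
Qed.

Lemma integral_Kker_invr3 t : I0 t ->
  (\int[mu]_(s in @I0 R) (Kker s t * ((1 + tan s ^+ 2) / rtan s ^+ 3))%:E <=
     (2 * pi / rtan t)%:E)%E.
Proof.
move=> t0; have /andP[t1 t2] : 0 < t < pi / 2 by rewrite -I0E.
rewrite (@ge0_integral_I0_split t)//; last 2 first.
- by apply: measurable_funM; [exact: measurable_Kker1|exact: measurable_weight].
- move=> s s0; rewrite mulr_ge0 ?Kker_ge0// divr_ge0 ?exprn_ge0 ?ltW ?rtan_gt0//.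
  by rewrite ltr_wpDr// sqr_ge0.
have -> : 2 * pi / rtan t = 2 / rtan t * (pi - (pi / 2 - ln 2)) +
    2 / rtan t * (pi / 2 - ln 2 - 0) by field; rewrite gt_eqF// rtan_gt0.
rewrite EFinD; apply: leeD; apply: integral_oo_Kker_invr3 => //; rewrite ?ltxx ?andbF//.
- exact: ltW.
- move=> s /andP[s0 st]; apply: logint_gt1; apply: rtan_div_gt1 => //.
  by rewrite I0E; lra.
- exact: ltW.
- move=> s /andP[s0 st]; apply: logint_lt1; apply: rtan_div_lt1 => //.
  by rewrite I0E; lra.
Qed.

End kernel_integrals.

(** * Weighted integrals of the kernel *)

Section skern.
Variable R : realType.
Notation mu := (@lebesgue_measure R).
Implicit Types (a b c s t x : R) (f g : R -> R).

Lemma measurable_I0 : measurable (@I0 R).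
Proof. exact: measurable_itv. Qed.

Lemma le_integral_I0 f g : measurable_fun setT f -> measurable_fun setT g ->
  (forall s, I0 s -> 0 <= f s <= g s) ->
  (\int[mu]_(s in @I0 R) (f s)%:E <= \int[mu]_(s in @I0 R) (g s)%:E)%E.
Proof.
move=> mf mg fg; apply: ge0_le_integral.
- exact: measurable_I0.
- by move=> s /fg/andP[]; rewrite lee_fin.
- by apply/measurable_EFinP; exact: measurable_funTS.
- by apply/measurable_EFinP; exact: measurable_funTS.
- by move=> s /fg/andP[_]; rewrite lee_fin.
Qed.

Lemma measurable_invr n : measurable_fun [set: R] (fun s => (rtan s ^+ n)^-1).
Proof.
apply: (measurableT_comp (@measurable_inv R)).
by apply: measurable_funX; exact: measurable_rtan.
Qed.

Lemma measurable_ltl t : measurable_fun [set: R] (fun s => (s < t)%R%:R : R).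
Proof.
rewrite (_ : (fun s => _) = \1_(`]-oo, t[)); first by apply: measurable_indic.
by apply/funext => s; rewrite indicE mem_setE in_itv.
Qed.

Lemma measurable_ltr s : measurable_fun [set: R] (fun t => (s < t)%R%:R : R).
Proof.
rewrite (_ : (fun t => _) = \1_(`]s, +oo[)); first by apply: measurable_indic.
by apply/funext => t; rewrite indicE mem_setE in_itv/= andbT.
Qed.

(** Inserting the factor [1 + tan s ^+ 2] makes the integrand the derivative of [2 * rtan s]. *)
Lemma integral_ltl_invr t : I0 t ->
  (\int[mu]_(s in @I0 R) ((s < t)%R%:R / rtan s)%:E <= (2 * rtan t)%:E)%E.
Proof.
move=> t0; have /andP[t1 t2] : 0 < t < pi / 2 by rewrite -I0E.
have m1 : measurable_fun [set: R] (fun s => (s < t)%R%:R / rtan s).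
  by apply: measurable_funM; [exact: measurable_ltl|exact: (measurable_invr 1)].
rewrite (@ge0_integral_I0_split _ t)//; last first.
  by move=> s s0; rewrite divr_ge0// ltW// rtan_gt0.
rewrite [X in (_ + X)%E]integral0_eq ?adde0; last first.
  by move=> s; rewrite /= in_itv/= => /andP[ts _]; rewrite ltNge ltW// mul0r.
have I0s s : 0 < s < t -> I0 s by rewrite I0E; lra.
apply: (@le_trans _ _ (\int[mu]_(s in `]0%R, t[) ((1 + tan s ^+ 2) / rtan s)%:E)%E).
  apply: ge0_le_integral => //=.
  - move=> s; rewrite in_itv/= => /I0s s0.
    by rewrite lee_fin divr_ge0// ltW// rtan_gt0.
  - by apply/measurable_EFinP; exact: measurable_funTS.
  - by apply/measurable_EFinP; apply: measurable_funTS; exact: (measurable_weight 1).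
  - move=> s; rewrite in_itv/= => /andP[s0 st]; rewrite lee_fin st.
    have s1 : I0 s by apply: I0s; rewrite s0.
    by rewrite ler_pM2r ?invr_gt0 ?rtan_gt0// lerDl sqr_ge0.
rewrite -[2 * rtan t]subr0; apply: (@integral_oo_le R (fun s => (1 + tan s ^+ 2) / rtan s) (fun s => 2 * rtan s)).
- exact: t1.
- move=> s /I0s s0; have ps := rtan_gt0 s0; have d := is_derive_rtan s0.
  apply: is_derive_eq; rewrite /GRing.scale/=; by field; rewrite gt_eqF.
- move=> s /I0s s0; exact: (@derivable_weight R 1 s s0).
- move=> s /I0s s0; have ps := rtan_gt0 s0.
  by rewrite divr_ge0 ?ltW// ltr_wpDr// sqr_ge0.
- move=> s st; have s0 := I0s _ st; have ps := rtan_gt0 s0.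
  rewrite mulr_ge0 ?(ltW ps)//= ler_pM2l// ltW// lt_rtan//.
  by case/andP: st.
Qed.

(** With the factor [1 + tan t ^+ 2] inserted, a primitive is [- (2 / rtan t)], which stays below 0
    up to [pi / 2]. *)
Lemma integral_ltr_invr3 s : I0 s ->
  (\int[mu]_(t in @I0 R) ((s < t)%R%:R / rtan t ^+ 3)%:E <= (2 / rtan s)%:E)%E.
Proof.
move=> t0; have /andP[t1 t2] : 0 < s < pi / 2 by rewrite -I0E.
have m1 : measurable_fun [set: R] (fun t => (s < t)%R%:R / rtan t ^+ 3).
  by apply: measurable_funM; [exact: measurable_ltr|exact: measurable_invr].
rewrite (@ge0_integral_I0_split _ s)//; last first.
  by move=> t s0; rewrite divr_ge0// exprn_ge0// ltW// rtan_gt0.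
rewrite [X in (X + _)%E]integral0_eq ?add0e; last first.
  by move=> t; rewrite /= in_itv/= => /andP[_ ts]; rewrite ltNge ltW// mul0r.
have I0s t : s < t < pi / 2 -> I0 t by rewrite I0E; lra.
apply: (@le_trans _ _ (\int[mu]_(t in `]s, (pi / 2)%R[) ((1 + tan t ^+ 2) / rtan t ^+ 3)%:E)%E).
  apply: ge0_le_integral => //=.
  - move=> t; rewrite in_itv/= => /I0s s0.
    by rewrite lee_fin divr_ge0// exprn_ge0// ltW// rtan_gt0.
  - by apply/measurable_EFinP; exact: measurable_funTS.
  - by apply/measurable_EFinP; apply: measurable_funTS; exact: measurable_weight.
  - move=> t; rewrite in_itv/= => /andP[s0 st]; rewrite lee_fin s0.
    have s1 : I0 t by apply: I0s; rewrite s0.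
    by rewrite ler_pM2r ?invr_gt0 ?exprn_gt0 ?rtan_gt0// lerDl sqr_ge0.
have -> : 2 / rtan s = 0 - (- (2 / rtan s)) by ring.
apply: (@integral_oo_le R (fun t => (1 + tan t ^+ 2) / rtan t ^+ 3) (fun t => - (2 / rtan t))).
- exact: t2.
- move=> t /I0s s0; have ps := rtan_gt0 s0; have d := is_derive_rtan s0.
  have pn := lt0r_neq0 ps.
  apply: is_derive_eq; rewrite /GRing.scale/=; by field; rewrite gt_eqF.
- move=> t /I0s s0; exact: (@derivable_weight R 3 t s0).
- move=> t /I0s s0; have ps := rtan_gt0 s0.
  by rewrite divr_ge0 ?exprn_ge0 ?ltW// ltr_wpDr// sqr_ge0.
- move=> t st; have s0 := I0s _ st; have ps := rtan_gt0 s0.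
  rewrite lerN2 oppr_le0 divr_ge0 ?(ltW ps)// andbT ler_pM2l// lef_pV2 ?posrE ?rtan_gt0//.
  by rewrite ltW// lt_rtan//; case/andP: st.
Qed.

(* With [a = b = 1] this kernel bounds [Phi v - Phi w]: [K / (3 pi)] comes from
   [H / 3] inside the sine, [1_{s < t}] from the exponent. *)
Definition skern a b s t := a / (3 * pi) * Kker s t + b * (s < t)%R%:R.

Lemma skern_ge0 a b s t : 0 <= a -> 0 <= b -> I0 s -> I0 t -> 0 <= skern a b s t.
Proof.
move=> a0 b0 s0 t0; rewrite addr_ge0// mulr_ge0// ?Kker_ge0// divr_ge0//.
by rewrite mulr_ge0// pi_ge0.
Qed.

Lemma measurable_skern a b : measurable_fun [set: R * R] (fun z => skern a b z.1 z.2).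
Proof.
apply: measurable_funD; apply: measurable_funM => //.
  exact: measurable_Kker.
have mlt : measurable_fun [set: R * R] (fun z => z.1 < z.2).
  exact: measurable_fun_ltr.
rewrite (_ : (fun z => _) = (fun z : R * R => if z.1 < z.2 then 1 else 0)); last first.
  by apply/funext => z; case: ifP.
exact: measurable_fun_ifT.
Qed.

Lemma measurable_skern1 a b t : measurable_fun [set: R] (fun s => skern a b s t).
Proof.
have mp : measurable_fun [set: R] (fun s => (s, t)) by exact: measurable_fun_pair.
exact: (measurableT_comp (measurable_skern a b) mp).
Qed.

Lemma measurable_skern2 a b s : measurable_fun [set: R] (fun t => skern a b s t).
Proof.
have mp : measurable_fun [set: R] (fun t => (s, t)) by exact: measurable_fun_pair.
exact: (measurableT_comp (measurable_skern a b) mp).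
Qed.

Lemma ge0_integral_I0_lin c d f g A B : 0 <= c -> 0 <= d ->
  measurable_fun setT f -> measurable_fun setT g ->
  (forall s, I0 s -> 0 <= f s) -> (forall s, I0 s -> 0 <= g s) ->
  (\int[mu]_(s in @I0 R) (f s)%:E <= A%:E)%E ->
  (\int[mu]_(s in @I0 R) (g s)%:E <= B%:E)%E ->
  (\int[mu]_(s in @I0 R) (c * f s + d * g s)%:E <= (c * A + d * B)%:E)%E.
Proof.
move=> c0 d0 mf mg f0 g0 fA gB.
have mF : measurable_fun (@I0 R) (EFin \o f).
  by apply/measurable_EFinP; exact: measurable_funTS.
have mG : measurable_fun (@I0 R) (EFin \o g).
  by apply/measurable_EFinP; exact: measurable_funTS.
under eq_integral do rewrite EFinD !EFinM.
rewrite ge0_integralD//=; first last.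
- exact: measurable_funeM.
- by move=> s s0; rewrite mule_ge0// lee_fin// g0.
- exact: measurable_funeM.
- by move=> s s0; rewrite mule_ge0// lee_fin// f0.
- exact: measurable_I0.
rewrite !ge0_integralZl_EFin//; try exact: measurable_I0.
rewrite EFinD !EFinM leeD// lee_wpmul2l ?lee_fin//.
Qed.

(** The factor 1 + tan^2 is at least 1, which gives the first bound from the exponent 1, and at
    least 2 tan, which gives the second from the exponent 3. The second decays as t approaches
    [pi / 2], where the first blows up. *)
Lemma integral_Kker_invr_le t : I0 t ->
  (\int[mu]_(s in @I0 R) (Kker s t / rtan s)%:E <= (2 * pi * rtan t)%:E)%E /\
  (\int[mu]_(s in @I0 R) (Kker s t / rtan s)%:E <= (pi / rtan t)%:E)%E.
Proof.
move=> t0.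
have m1 : measurable_fun [set: R] (fun s => Kker s t / rtan s).
  by apply: measurable_funM; [exact: measurable_Kker1|exact: (measurable_invr 1)].
split.
  apply: le_trans (integral_Kker_invr t0); apply: le_integral_I0 => //.
    by apply: measurable_funM; [exact: measurable_Kker1|exact: (measurable_weight 1)].
  move=> s s0; have ps := rtan_gt0 s0; have k0 := Kker_ge0 s0 t0.
  rewrite divr_ge0 ?(ltW ps)//= ler_wpM2l// ler_peMl ?invr_ge0 ?(ltW ps)//.
  by rewrite lerDl sqr_ge0.
have -> : pi / rtan t = 2^-1 * (2 * pi / rtan t) + 0 * 0.
  by field; rewrite gt_eqF// rtan_gt0.
apply: (@le_trans _ _ (\int[mu]_(s in @I0 R) (2^-1 *
   (Kker s t * ((1 + tan s ^+ 2) / rtan s ^+ 3)) + 0 * cst 0 s)%:E)%E).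
  apply: le_integral_I0 => //.
    apply: measurable_funD => //; apply: measurable_funM => //.
    by apply: measurable_funM; [exact: measurable_Kker1|exact: measurable_weight].
  move=> s s0; have ps := rtan_gt0 s0; have k0 := Kker_ge0 s0 t0.
  rewrite divr_ge0 ?(ltW ps)//= mul0r addr0 mulrCA ler_wpM2l// -(sqr_rtan s0).
  rewrite mulrA ler_pdivlMr ?exprn_gt0//.
  have -> : (rtan s)^-1 * rtan s ^+ 3 = rtan s ^+ 2 by field; rewrite gt_eqF.
  have := sqr_ge0 (1 - rtan s ^+ 2); nra.
apply: ge0_integral_I0_lin => //.
- by apply: measurable_funM; [exact: measurable_Kker1|exact: measurable_weight].
- move=> s s0; have ps := rtan_gt0 s0; have k0 := Kker_ge0 s0 t0.
  by rewrite mulr_ge0// divr_ge0 ?exprn_ge0 ?ltW// ltr_wpDr// sqr_ge0.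
- exact: integral_Kker_invr3.
- by rewrite integral0_eq.
Qed.

Lemma integral_Kker_invr3_le t : I0 t ->
  (\int[mu]_(s in @I0 R) (Kker s t / rtan s ^+ 3)%:E <= (2 * pi / rtan t)%:E)%E.
Proof.
move=> t0; apply: le_trans (integral_Kker_invr3 t0); apply: le_integral_I0.
- by apply: measurable_funM; [exact: measurable_Kker1|exact: measurable_invr].
- by apply: measurable_funM; [exact: measurable_Kker1|exact: measurable_weight].
move=> s s0; have ps := rtan_gt0 s0; have k0 := Kker_ge0 s0 t0.
rewrite divr_ge0 ?exprn_ge0 ?(ltW ps)//= ler_wpM2l// ler_peMl ?invr_ge0 ?exprn_ge0 ?(ltW ps)//.
by rewrite lerDl sqr_ge0.
Qed.

Lemma integral_skern_invr a b t : 0 <= a -> 0 <= b -> I0 t ->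
  (\int[mu]_(s in @I0 R) (skern a b s t / rtan s)%:E <=
    ((a * (2 / 3) + b * 2) * rtan t)%:E)%E.
Proof.
move=> a0 b0 t0.
have -> : (a * (2 / 3) + b * 2) * rtan t =
    a / (3 * pi) * (2 * pi * rtan t) + b * (2 * rtan t).
  by move: (pi : R) (pi_gt0 R) => p p0; field; rewrite gt_eqF.
rewrite [leLHS](_ : _ = \int[mu]_(s in @I0 R) (a / (3 * pi) * (Kker s t / rtan s) +
    b * ((s < t)%R%:R / rtan s))%:E)%E; last first.
  by apply: eq_integral => s _; rewrite /skern mulrDl !mulrA.
apply: (@ge0_integral_I0_lin (a / (3 * pi)) b (fun s => Kker s t / rtan s)
  (fun s => (s < t)%R%:R / rtan s)) => //.
- by rewrite divr_ge0// mulr_ge0// pi_ge0.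
- by apply: measurable_funM; [exact: measurable_Kker1|exact: (measurable_invr 1)].
- by apply: measurable_funM; [exact: measurable_ltl|exact: (measurable_invr 1)].
- by move=> s s0; rewrite divr_ge0 ?Kker_ge0// ltW// rtan_gt0.
- by move=> s s0; rewrite divr_ge0 // ltW// rtan_gt0.
- by case: (integral_Kker_invr_le t0).
- exact: integral_ltl_invr.
Qed.

(** Transposed half of Schur's test: the weight is cot t times [(rtan t)^-1]. The constant agrees
    with that of [integral_skern_invr], so it appears squared in the L^2 bound. *)
Lemma integral_skern_invr3 a b s : 0 <= a -> 0 <= b -> I0 s ->
  (\int[mu]_(t in @I0 R) (skern a b s t / rtan t ^+ 3)%:E <=
    ((a * (2 / 3) + b * 2) / rtan s)%:E)%E.
Proof.
move=> a0 b0 t0.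
have -> : (a * (2 / 3) + b * 2) / rtan s =
    a / (3 * pi) * (2 * pi / rtan s) + b * (2 / rtan s).
  by move: (pi : R) (pi_gt0 R) => p p0; field; rewrite !gt_eqF ?rtan_gt0.
rewrite [leLHS](_ : _ = \int[mu]_(t in @I0 R) (a / (3 * pi) * (Kker t s / rtan t ^+ 3) +
    b * ((s < t)%R%:R / rtan t ^+ 3))%:E)%E; last first.
  by apply: eq_integral => t _; rewrite /skern mulrDl !mulrA KkerC.
apply: (@ge0_integral_I0_lin (a / (3 * pi)) b (fun t => Kker t s / rtan t ^+ 3)
  (fun t => (s < t)%R%:R / rtan t ^+ 3)) => //.
- by rewrite divr_ge0// mulr_ge0// pi_ge0.
- by apply: measurable_funM; [exact: measurable_Kker1|exact: measurable_invr].
- by apply: measurable_funM; [exact: measurable_ltr|exact: measurable_invr].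
- by move=> t s0; rewrite divr_ge0 ?Kker_ge0// exprn_ge0// ltW// rtan_gt0.
- by move=> t s0; rewrite divr_ge0 // exprn_ge0// ltW// rtan_gt0.
- exact: integral_Kker_invr3_le.
- exact: integral_ltr_invr3.
Qed.

End skern.

(** * Schur's test *)

Section tonelli.
Variable R : realType.
Notation mu := (@lebesgue_measure R).
Implicit Types (a b c s t x : R) (f g h : R -> R) (F : R -> R -> R).

(** Extension by 0 off the square: Tonelli's theorem is applied on the whole plane, while
    non-negativity is known on the square only. *)
Let dbl F := ((fun z : R * R => (F z.1 z.2)%:E) \_ (@I0 R `*` @I0 R)).

Let dbl_ge0 F : (forall s t, I0 s -> I0 t -> 0 <= F s t) ->
  forall z, (0 <= dbl F z)%E.
Proof.
move=> F0 z; apply: erestrict_ge0 => -[s t]/= [s0 t0].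
by rewrite lee_fin F0.
Qed.

Let measurable_dbl F : measurable_fun setT (fun z : R * R => F z.1 z.2) ->
  measurable_fun setT (dbl F).
Proof.
move=> mF; apply/(measurable_restrictT _ _).1.
  by apply: measurableX; exact: measurable_I0.
by apply: measurable_funTS; apply/measurable_EFinP.
Qed.

Let dbl1 F t : I0 t ->
  (\int[mu]_s dbl F (s, t) = \int[mu]_(s in @I0 R) (F s t)%:E)%E.
Proof.
move=> t0; rewrite [RHS]integral_mkcond; apply: eq_integral => s _.
rewrite /dbl !patchE/=.
by congr (if _ then _ else _); apply/idP/idP; rewrite !inE//= => -[].
Qed.

Let dbl2 F s : I0 s ->
  (\int[mu]_t dbl F (s, t) = \int[mu]_(t in @I0 R) (F s t)%:E)%E.
Proof.
move=> s0; rewrite [RHS]integral_mkcond; apply: eq_integral => t _.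
rewrite /dbl !patchE/=.
by congr (if _ then _ else _); apply/idP/idP; rewrite !inE//= => -[].
Qed.

Lemma measurable_integral_I0 F : measurable_fun setT (fun z : R * R => F z.1 z.2) ->
  (forall s t, I0 s -> I0 t -> 0 <= F s t) ->
  measurable_fun (@I0 R) (fun t => (\int[mu]_(s in @I0 R) (F s t)%:E)%E).
Proof.
move=> mF F0.
have := @measurable_fun_fubini_tonelli_G _ _ _ _ R mu _ (measurable_dbl mF) (dbl_ge0 F0).
move=> /(measurable_funTS (D := @I0 R)); apply: eq_measurable_fun => t.
by rewrite inE => t0; rewrite /fubini_G dbl1.
Qed.

Lemma tonelli_I0 F : measurable_fun setT (fun z : R * R => F z.1 z.2) ->
  (forall s t, I0 s -> I0 t -> 0 <= F s t) ->
  (\int[mu]_(t in @I0 R) \int[mu]_(s in @I0 R) (F s t)%:E =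
   \int[mu]_(s in @I0 R) \int[mu]_(t in @I0 R) (F s t)%:E)%E.
Proof.
move=> mF F0.
have := @fubini_tonelli _ _ _ _ R mu mu _ (measurable_dbl mF) (dbl_ge0 F0).
move=> E; rewrite integral_mkcond [RHS]integral_mkcond.
transitivity (\int[mu]_t \int[mu]_s dbl F (s, t))%E.
  apply: eq_integral => t _; rewrite patchE; case: ifPn => [|nt].
    by rewrite inE => t0; rewrite dbl1.
  rewrite integral0_eq// => s _; rewrite /dbl patchE ifF//.
  by apply: contraNF nt; rewrite !inE => -[].
rewrite -E; apply: eq_integral => s _; rewrite patchE; case: ifPn => [|ns].
  by rewrite inE => s0; rewrite dbl2.
rewrite integral0_eq// => t _; rewrite /dbl patchE ifF//.
by apply: contraNF ns; rewrite !inE => -[].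
Qed.

End tonelli.

Section schur_test.
Variable R : realType.
Notation mu := (@lebesgue_measure R).
Implicit Types (a b c s t x : R) (f g h : R -> R).

(** Cauchy-Schwarz without square roots: for finite non-zero X the choice r = X / A is optimal and
    gives X <= X / 2 + A B / (2 X). An infinite B is harmless because A > 0. *)
Lemma le_sqr_of_amgm (A : R) (X B : \bar R) : 0 < A -> (0 <= X)%E -> (0 <= B)%E ->
  (forall r, 0 < r -> (X <= (r / 2 * A)%:E + (2 * r)^-1%:E * B)%E) ->
  (X * X <= A%:E * B)%E.
Proof.
move=> A0 X0; case: B => [b| |] // b0 H; last by rewrite gt0_muley ?lte_fin// leey.
have : (X < +oo)%E by rewrite (le_lt_trans (H 1 ltr01))// -EFinM -EFinD ltry.
case: X X0 H => [x| |] // x0 H _.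
rewrite !lee_fin in x0 b0 *.
have [->|xn] := eqVneq x 0; first by rewrite mulr0 mulr_ge0// ltW.
have xp : 0 < x by rewrite lt_neqAle eq_sym xn.
have := H (x / A) (divr_gt0 xp A0).
rewrite -!EFinM -EFinD !lee_fin.
have -> : x / A / 2 * A = x / 2 by field; rewrite gt_eqF.
have -> : (2 * (x / A))^-1 * b = A * b / (2 * x) by field; rewrite !gt_eqF.
move=> h; have : x / 2 <= A * b / (2 * x) by lra.
rewrite ler_pdivlMr ?mulr_gt0//.
by have -> : x / 2 * (2 * x) = x * x by field.
Qed.

Definition Sop a b h t : \bar R := (\int[mu]_(s in @I0 R) (skern a b s t * h s)%:E)%E.

Lemma Sop_ge0 a b h t : 0 <= a -> 0 <= b -> (forall s, I0 s -> 0 <= h s) -> I0 t ->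
  (0 <= Sop a b h t)%E.
Proof.
by move=> a0 b0 h0 t0; apply: integral_ge0 => s s0; rewrite lee_fin mulr_ge0 ?skern_ge0 ?h0.
Qed.

Lemma measurable_skernM a b g h : measurable_fun setT g -> measurable_fun setT h ->
  measurable_fun setT (fun z : R * R => g z.2 * (skern a b z.1 z.2 * h z.1)).
Proof.
move=> mg mh; apply: measurable_funM.
  exact: (measurableT_comp mg measurable_snd).
apply: measurable_funM; first exact: measurable_skern.
exact: (measurableT_comp mh measurable_fst).
Qed.

Lemma measurable_Sop a b h : 0 <= a -> 0 <= b -> measurable_fun setT h ->
  (forall s, I0 s -> 0 <= h s) -> measurable_fun (@I0 R) (Sop a b h).
Proof.
move=> a0 b0 mh h0.
apply: (@measurable_integral_I0 R (fun s t => skern a b s t * h s)).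
  apply: measurable_funM; first exact: measurable_skern.
  exact: (measurableT_comp mh measurable_fst).
by move=> s t s0 t0; rewrite mulr_ge0 ?skern_ge0 ?h0.
Qed.

(** Cauchy-Schwarz for the measure [skern a b s t] ds, after splitting h as rtan^(-1/2) times
    rtan^(1/2) h; the first factor is integrated by [integral_skern_invr]. *)
Lemma Sop_sqr_le a b h t : 0 < a -> 0 <= b -> measurable_fun setT h ->
  (forall s, I0 s -> 0 <= h s) -> I0 t ->
  (Sop a b h t * Sop a b h t <= ((a * (2 / 3) + b * 2) * rtan t)%:E *
    Sop a b (fun s => (rtan s * h s ^+ 2)%R) t)%E.
Proof.
move=> a0 b0 mh h0 t0; have pt := rtan_gt0 t0.
have c0 : 0 < a * (2 / 3) + b * 2 by lra.
have m1 : measurable_fun [set: R] (fun s => skern a b s t / rtan s).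
  by apply: measurable_funM; [exact: measurable_skern1|exact: (measurable_invr 1)].
have m2 : measurable_fun [set: R] (fun s => skern a b s t * (rtan s * h s ^+ 2)).
  apply: measurable_funM; first exact: measurable_skern1.
  by apply: measurable_funM; [exact: measurable_rtan|exact: measurable_funX].
have k0 s : I0 s -> 0 <= skern a b s t by move=> s0; rewrite skern_ge0// ltW.
have n2 s : I0 s -> 0 <= rtan s * h s ^+ 2.
  by move=> s0; rewrite mulr_ge0 ?exprn_ge0 ?h0// ltW// rtan_gt0.
apply: le_sqr_of_amgm.
- exact: mulr_gt0.
- by rewrite Sop_ge0// ltW.
- by rewrite Sop_ge0// ltW.
move=> r r0.
apply: (@le_trans _ _ (\int[mu]_(s in @I0 R) ((r / 2)%:E * (skern a b s t / rtan s)%:E +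
   (2 * r)^-1%:E * (skern a b s t * (rtan s * h s ^+ 2))%:E))%E).
  apply: (@le_integral_I0 R (fun s => skern a b s t * h s)
    (fun s => r / 2 * (skern a b s t / rtan s) + (2 * r)^-1 * (skern a b s t * (rtan s * h s ^+ 2)))).
  - by apply: measurable_funM => //; exact: measurable_skern1.
  - by apply: measurable_funD; apply: measurable_funM.
  - move=> s s0; rewrite mulr_ge0 ?k0 ?h0//=.
    have ps := rtan_gt0 s0.
    have -> : r / 2 * (skern a b s t / rtan s) + (2 * r)^-1 * (skern a b s t * (rtan s * h s ^+ 2))
      = skern a b s t * ((r ^+ 2 + (rtan s * h s) ^+ 2) / (2 * r * rtan s)).
      move: (skern a b s t) => k; by field; rewrite !gt_eqF.
    rewrite ler_wpM2l ?k0// ler_pdivlMr ?mulr_gt0//.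
    have := sqr_ge0 (r - rtan s * h s); nra.
rewrite ge0_integralD//=; first last.
- by apply/measurable_EFinP; apply: measurable_funTS; apply: measurable_funM.
- move=> s s0; apply: mule_ge0; rewrite lee_fin; last exact: mulr_ge0 (k0 _ s0) (n2 _ s0).
  by rewrite invr_ge0 mulr_ge0// ltW.
- by apply/measurable_EFinP; apply: measurable_funTS; apply: measurable_funM.
- by move=> s s0; have ps := rtan_gt0 s0; rewrite mule_ge0 ?lee_fin ?divr_ge0 ?k0 ?(ltW r0) ?(ltW ps).
- exact: measurable_I0.
have mE f : measurable_fun setT f -> measurable_fun (@I0 R) (fun s => (f s)%:E).
  by move=> mf; apply/measurable_EFinP; exact: measurable_funTS.
rewrite !ge0_integralZl_EFin//; try exact: measurable_I0; try exact: mE.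
- apply: leeD2r; rewrite [leRHS]EFinM; apply: lee_wpmul2l; first by rewrite lee_fin divr_ge0// ltW.
  by apply: integral_skern_invr => //; exact: ltW.
- by move=> s s0; rewrite lee_fin; exact: mulr_ge0 (k0 _ s0) (n2 _ s0).
- by rewrite invr_ge0 mulr_ge0// ltW.
- by move=> s s0; rewrite lee_fin divr_ge0 ?k0// ltW// rtan_gt0.
- by rewrite divr_ge0 // ltW.
Qed.

(** The weight [(rtan t ^+ 4)^-1] is cot^2 t, and [Sop_sqr_le] lowers it to [(rtan t ^+ 3)^-1].
    After exchanging the integrals, the transposed estimate returns [(rtan s)^-1], which cancels the
    weight on h^2. *)
Lemma schur a b h : 0 < a -> 0 <= b -> measurable_fun setT h ->
  (forall s, I0 s -> 0 <= h s) ->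
  (\int[mu]_(t in @I0 R) ((rtan t ^+ 4)^-1%:E * (Sop a b h t * Sop a b h t)) <=
   ((a * (2 / 3) + b * 2) ^+ 2)%:E * \int[mu]_(s in @I0 R) (h s ^+ 2)%:E)%E.
Proof.
move=> a0 b0 mh h0.
set c := a * (2 / 3) + b * 2.
have c0 : 0 < c by rewrite /c; lra.
have mE f : measurable_fun setT f -> measurable_fun (@I0 R) (fun s => (f s)%:E).
  by move=> mf; apply/measurable_EFinP; exact: measurable_funTS.
have mS := measurable_Sop (ltW a0) b0 mh h0.
have mw : measurable_fun [set: R] (fun s => rtan s * h s ^+ 2).
  by apply: measurable_funM; [exact: measurable_rtan|exact: measurable_funX].
have w0 s : I0 s -> 0 <= rtan s * h s ^+ 2.
  by move=> s0; rewrite mulr_ge0 ?exprn_ge0 ?h0// ltW// rtan_gt0.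
have mg : measurable_fun [set: R] (fun t => c / rtan t ^+ 3).
  by apply: measurable_funM => //; exact: measurable_invr.
have mF := measurable_skernM a b mg mw.
have F0 s t : I0 s -> I0 t -> 0 <= c / rtan t ^+ 3 * (skern a b s t * (rtan s * h s ^+ 2)).
  move=> s0 t0; have k0 := skern_ge0 (ltW a0) b0 s0 t0.
  apply: mulr_ge0; last exact: mulr_ge0 k0 (w0 _ s0).
  by rewrite divr_ge0 ?exprn_ge0 ?(ltW c0)// ltW// rtan_gt0.
apply: (@le_trans _ _ (\int[mu]_(t in @I0 R) \int[mu]_(s in @I0 R)
    (c / rtan t ^+ 3 * (skern a b s t * (rtan s * h s ^+ 2)))%:E)%E).
  apply: ge0_le_integral.
  - exact: measurable_I0.
  - move=> t t0; rewrite mule_ge0 ?lee_fin ?invr_ge0 ?exprn_ge0 ?(ltW (rtan_gt0 t0))//.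
    by rewrite mule_ge0// Sop_ge0// ltW.
  - apply: emeasurable_funM; first by apply: mE; exact: measurable_invr.
    exact: emeasurable_funM.
  - exact: (measurable_integral_I0 mF F0).
  - move=> t t0; have pt := rtan_gt0 t0.
    under eq_integral do rewrite EFinM.
    rewrite ge0_integralZl_EFin; first last.
    + by rewrite divr_ge0 ?exprn_ge0 ?ltW.
    + by apply: mE; apply: measurable_funM => //; exact: measurable_skern1.
    + by move=> s s0; rewrite lee_fin; exact: mulr_ge0 (skern_ge0 (ltW a0) b0 s0 t0) (w0 _ s0).
    + exact: measurable_I0.
    apply: (@le_trans _ _ ((rtan t ^+ 4)^-1%:E * ((c * rtan t)%:E *
      Sop a b (fun s => (rtan s * h s ^+ 2)%R) t))%E).
      apply: lee_wpmul2l; last exact: Sop_sqr_le.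
      by rewrite lee_fin invr_ge0 exprn_ge0// ltW.
    rewrite muleA -EFinM.
    by have -> : (rtan t ^+ 4)^-1 * (c * rtan t) = c / rtan t ^+ 3 by field; rewrite gt_eqF.
rewrite (tonelli_I0 mF F0).
rewrite -ge0_integralZl_EFin; first last.
- by rewrite exprn_ge0// ltW.
- by apply: mE; exact: measurable_funX.
- by move=> s s0; rewrite lee_fin sqr_ge0.
- exact: measurable_I0.
apply: ge0_le_integral.
- exact: measurable_I0.
- by move=> s s0; apply: integral_ge0 => t t0; rewrite lee_fin F0.
- apply: (@measurable_integral_I0 R (fun t s => c / rtan t ^+ 3 * (skern a b s t * (rtan s * h s ^+ 2)))).
    exact: (measurableT_comp mF (@measurable_swap _ _ _ _)).
  by move=> s t s0 t0; exact: F0.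
- apply: measurable_funeM; apply: mE; exact: measurable_funX.
move=> s s0; have ps := rtan_gt0 s0.
rewrite [leLHS](_ : _ = \int[mu]_(t in @I0 R) ((c * (rtan s * h s ^+ 2))%:E *
   (skern a b s t / rtan t ^+ 3)%:E))%E; last first.
  apply: eq_integral => t _; rewrite -EFinM; congr EFin.
  by rewrite -!mulrA; congr (_ * _); rewrite mulrC -!mulrA; ring.
rewrite ge0_integralZl_EFin; first last.
- by apply: mulr_ge0; [exact: ltW|exact: w0].
- by apply: mE; apply: measurable_funM; [exact: measurable_skern2|exact: measurable_invr].
- move=> t t0; rewrite lee_fin divr_ge0 ?skern_ge0 ?(ltW a0)//.
  by rewrite exprn_ge0// ltW// rtan_gt0.
- exact: measurable_I0.
apply: (@le_trans _ _ ((c * (rtan s * h s ^+ 2))%:E * (c / rtan s)%:E)%E).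
  apply: lee_wpmul2l; first by rewrite lee_fin; apply: mulr_ge0; [exact: ltW|exact: w0].
  by apply: integral_skern_invr3 => //; exact: ltW.
rewrite -!EFinM lee_fin.
by have -> : c * (rtan s * h s ^+ 2) * (c / rtan s) = c ^+ 2 * h s ^+ 2 by field; rewrite gt_eqF.
Qed.

End schur_test.

(** * Lipschitz estimates for [Phi] *)

Section Phi_estimates.
Variable R : realType.
Notation mu := (@lebesgue_measure R).
Implicit Types (alpha a b c s t x y : R) (v w : R -> R).

Lemma sin_lipschitz x y : `|sin x - sin y| <= `|x - y|.
Proof.
wlog xy : x y / x <= y.
  by move=> H; have [/H//|/ltW/H] := leP x y; rewrite distrC [leRHS]distrC.
rewrite distrC [leRHS]distrC.
have [|c _ ->] := @MVT_segment R sin cos x y xy (fun z _ => is_derive_sin z).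
  by apply: continuous_subspaceT; exact: continuous_sin.
by rewrite normrM ler_piMl// cos_max.
Qed.

Lemma expR_lipschitz x y : 0 <= x -> 0 <= y ->
  `|(expR x)^-1 - (expR y)^-1| <= `|x - y|.
Proof.
wlog xy : x y / x <= y.
  move=> H x0 y0; have [/H|/ltW/H] := leP x y; first exact.
  by move=> /(_ y0 x0); rewrite distrC (distrC y).
move=> x0 y0; rewrite -!expRN.
have -> : expR (- y) = expR (- x) * expR (x - y) by rewrite -expRD; congr expR; ring.
have e1 : expR (- x) <= 1 by rewrite expR_le1 oppr_le0.
have e0 : 0 < expR (- x) by exact: expR_gt0.
have e2 : expR (x - y) <= 1 by rewrite expR_le1; lra.
have e3 := expR_ge1Dx (x - y).
rewrite ger0_norm; last by nra.
by rewrite ler0_norm; [nra|lra].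
Qed.

Lemma sin_div_expR_lipschitz t x1 x2 y1 y2 : 0 <= y1 -> 0 <= y2 ->
  `|sin (t + x1) / expR y1 - sin (t + x2) / expR y2| <= `|x1 - x2| + `|y1 - y2|.
Proof.
move=> y10 y20.
have -> : sin (t + x1) / expR y1 - sin (t + x2) / expR y2 =
  (sin (t + x1) - sin (t + x2)) / expR y1 + sin (t + x2) * ((expR y1)^-1 - (expR y2)^-1).
  by ring.
apply: (le_trans (ler_normD _ _)); rewrite !normrM; apply: lerD.
  have h := sin_lipschitz (t + x1) (t + x2).
  have E : t + x1 - (t + x2) = x1 - x2 by ring.
  rewrite E in h; apply: le_trans h; rewrite ler_piMr// ger0_norm ?invr_ge0 ?expR_ge0//.
  by rewrite invf_le1 ?expR_gt0// -expR0 ler_expR.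
apply: le_trans (expR_lipschitz y10 y20).
by rewrite ler_piMl// sin_max.
Qed.

(** Measurability is global so that functions of two variables built from w are measurable on the
    plane; functions given on the interval are first extended by 0. *)
Definition nnmeas w := measurable_fun setT w /\ forall s, I0 s -> 0 <= w s.

Lemma nnmeasD v w : nnmeas v -> nnmeas w -> nnmeas (fun s => v s + w s).
Proof.
move=> [mv v0] [mw w0]; split; first exact: measurable_funD.
by move=> s s0; rewrite addr_ge0 ?v0 ?w0.
Qed.

Lemma nnmeas_dist v w : nnmeas v -> nnmeas w -> nnmeas (fun s => `|v s - w s|).
Proof.
move=> [mv v0] [mw w0]; split => //.
by apply: measurableT_comp => //; exact: measurable_funB.
Qed.

Lemma measurable_skernM1 a b w t : measurable_fun setT w ->
  measurable_fun (@I0 R) (fun s => (skern a b s t * w s)%:E).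
Proof.
move=> mw; apply/measurable_EFinP; apply: measurable_funTS.
by apply: measurable_funM => //; exact: measurable_skern1.
Qed.

Section pointwise.
Variables (a b t : R).
Hypotheses (a0 : 0 <= a) (b0 : 0 <= b) (t0 : I0 t).

Let S v := Sop a b v t.

Lemma nnSop_ge0 v : nnmeas v -> (0 <= S v)%E.
Proof. by move=> [mv v0]; exact: Sop_ge0. Qed.

Lemma Sop_le v w : nnmeas v -> nnmeas w -> (forall s, I0 s -> v s <= w s) ->
  (S v <= S w)%E.
Proof.
move=> [mv v0] [mw w0] vw; apply: ge0_le_integral.
- exact: measurable_I0.
- by move=> s s0; rewrite lee_fin mulr_ge0 ?skern_ge0 ?v0.
- exact: measurable_skernM1.
- exact: measurable_skernM1.
- by move=> s s0; rewrite lee_fin ler_wpM2l ?skern_ge0 ?vw.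
Qed.

Lemma SopD v w : nnmeas v -> nnmeas w -> S (fun s => v s + w s) = (S v + S w)%E.
Proof.
move=> [mv v0] [mw w0]; rewrite /S /Sop -ge0_integralD.
- by apply: eq_integral => s _; rewrite mulrDr EFinD.
- exact: measurable_I0.
- by move=> s s0; rewrite lee_fin mulr_ge0 ?skern_ge0 ?v0.
- exact: measurable_skernM1.
- by move=> s s0; rewrite lee_fin mulr_ge0 ?skern_ge0 ?w0.
- exact: measurable_skernM1.
Qed.

(** Only monotonicity and additivity on non-negative functions are used: v <= w + |v - w| and its
    mirror image give the estimate, and |v - w| <= v + w gives finiteness. No signed integral
    occurs. *)
Lemma Sop_dist v w : nnmeas v -> nnmeas w ->
  S v \is a fin_num -> S w \is a fin_num ->
  S (fun s => `|v s - w s|) \is a fin_num /\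
  `|fine (S v) - fine (S w)| <= fine (S (fun s => `|v s - w s|)).
Proof.
move=> nv nw fv fw; have nd := nnmeas_dist nv nw.
have fd : S (fun s => `|v s - w s|) \is a fin_num.
  rewrite ge0_fin_numE ?nnSop_ge0//.
  apply: (@le_lt_trans _ _ (S (fun s => v s + w s))).
    apply: Sop_le => //; first exact: nnmeasD.
    move=> s s0; have := nv.2 s s0; have := nw.2 s s0.
    by case: (ger0P (v s - w s)); lra.
  by rewrite SopD// lte_add_pinfty// -ge0_fin_numE// nnSop_ge0.
have le v' w' : nnmeas v' -> nnmeas w' -> S v' \is a fin_num -> S w' \is a fin_num ->
    (forall s, I0 s -> v' s <= w' s + `|v s - w s|) ->
    fine (S v') <= fine (S w') + fine (S (fun s => `|v s - w s|)).
  move=> nv' nw' fv' fw' h; rewrite -lee_fin EFinD !fineK// -SopD//.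
  by apply: Sop_le => //; exact: nnmeasD.
split=> //.
have h1 := le v w nv nw fv fw.
have h2 := le w v nw nv fw fv.
rewrite ler_norml; apply/andP; split.
  have : fine (S w) <= fine (S v) + fine (S (fun s => `|v s - w s|)).
    by apply: h2 => s s0; case: (ger0P (v s - w s)); lra.
  lra.
have : fine (S v) <= fine (S w) + fine (S (fun s => `|v s - w s|)).
  by apply: h1 => s s0; case: (ger0P (v s - w s)); lra.
lra.
Qed.

End pointwise.

Lemma Sop11E v t : I0 t -> nnmeas v -> Sop 1 1 v t = (Sop 1 0 v t + Sop 0 1 v t)%E.
Proof.
move=> t0 [mv v0]; rewrite /Sop -ge0_integralD.
- apply: eq_integral => s _; rewrite -EFinD; congr EFin.
  by rewrite /skern !mul0r addr0 add0r -mulrDl.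
- exact: measurable_I0.
- by move=> s s0; rewrite lee_fin mulr_ge0 ?skern_ge0 ?v0.
- exact: measurable_skernM1.
- by move=> s s0; rewrite lee_fin mulr_ge0 ?skern_ge0 ?v0.
- exact: measurable_skernM1.
Qed.

Lemma Hop_div3E w t : I0 t -> nnmeas w -> Hop w t / 3 = fine (Sop 1 0 w t).
Proof.
move=> t0 [mw w0]; rewrite /Hop /Sop /Rintegral.
have -> : (\int[mu]_(s in @I0 R) (skern 1 0 s t * w s)%:E =
    (3 * pi)^-1%:E * \int[mu]_(s in @I0 R) (Kker s t * w s)%:E)%E.
  rewrite -ge0_integralZl_EFin.
  - apply: eq_integral => s _; rewrite -EFinM; congr EFin.
    by rewrite /skern !mul0r addr0 mul1r mulrA.
  - exact: measurable_I0.
  - by move=> s s0; rewrite lee_fin mulr_ge0 ?Kker_ge0 ?w0.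
  - apply/measurable_EFinP; apply: measurable_funTS.
    by apply: measurable_funM => //; exact: measurable_Kker1.
  - by rewrite invr_ge0 mulr_ge0// pi_ge0.
have i0 : (0 <= \int[mu]_(s in @I0 R) (Kker s t * w s)%:E)%E.
  by apply: integral_ge0 => s s0; rewrite lee_fin mulr_ge0 ?Kker_ge0 ?w0.
have p0 : 0 < (3 * pi)^-1 :> R by rewrite invr_gt0 mulr_gt0// pi_gt0.
case: (\int[mu]_(s in _) _)%E i0 => [r| |] //= _.
  by rewrite invfM mulrAC [_ * 3^-1]mulrC.
(* For an infinite integral, [fine] makes both sides 0. *)
by rewrite gt0_muley ?lte_fin//= mulr0 mul0r.
Qed.

Lemma integral0tE w t : I0 t -> measurable_fun (@I0 R) w ->
  (\int[mu]_(s in `[0%R, t]) (w s)%:E = \int[mu]_(s in @I0 R) ((s < t)%R%:R * w s)%:E)%E.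
Proof.
move=> t0 mw.
have sub : `]0, t[%classic `<=` @I0 R.
  by move=> s /=; rewrite in_itv/= I0E; move: t0; rewrite I0E; lra.
have mw' : measurable_fun `]0, t[ (fun s => (w s)%:E).
  by apply/measurable_EFinP; apply: measurable_funS mw => //; exact: measurable_I0.
rewrite (integral_itv_bndoo true false mw').
rewrite integral_mkcond [RHS]integral_mkcond; apply: eq_integral => s _.
rewrite !patchE; case: ifPn => [|st].
  rewrite inE => s1; rewrite ifT; last by rewrite inE; exact: sub.
  by move: s1; rewrite /= in_itv/= => /andP[_ ->]; rewrite mul1r.
case: ifPn => // s0; rewrite (_ : (s < t) = false) ?mul0r//.
apply: contraNF st => st; rewrite inE/= in_itv/= st andbT.
by move: s0; rewrite inE I0E => /andP[].
Qed.

Lemma Rintegral0tE w t : I0 t -> nnmeas w -> Rintegral mu `[0, t] w = fine (Sop 0 1 w t).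
Proof.
move=> t0 [mw w0]; rewrite /Rintegral integral0tE//; last exact: measurable_funTS.
congr fine; apply: eq_integral => s _.
by rewrite /skern !mul0r add0r mul1r.
Qed.

Lemma cotE t : I0 t -> cos t / sin t = (rtan t ^+ 2)^-1.
Proof. by move=> t0; rewrite sqr_rtan// /tan invf_div. Qed.

Lemma PhiE alpha w t : I0 t -> nnmeas w -> Phi alpha w t =
  3 / (alpha * pi) / rtan t ^+ 2 *
    (sin (t + fine (Sop 1 0 w t)) / expR (fine (Sop 0 1 w t))).
Proof.
move=> t0 nw; rewrite /Phi Hop_div3E// Rintegral0tE// cotE//.
by move: (sin _) (expR _)^-1 (rtan t ^+ 2)^-1 (alpha * pi)^-1 => A B C D; ring.
Qed.

(** The finiteness assumptions exclude the default value of [fine], under which the values of [Phi]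
    would no longer reflect the integrals being compared. *)
Lemma Phi_lipschitz alpha v w t : 0 < alpha -> I0 t -> nnmeas v -> nnmeas w ->
  (Sop 1 1 v t < +oo)%E -> (Sop 1 1 w t < +oo)%E ->
  (Sop 1 1 (fun s => `|v s - w s|%R) t < +oo)%E /\
  `|Phi alpha v t - Phi alpha w t| <=
    3 / (alpha * pi) / rtan t ^+ 2 * fine (Sop 1 1 (fun s => `|v s - w s|) t).
Proof.
move=> al0 t0 nv nw fv fw.
have fin u : nnmeas u -> (Sop 1 1 u t < +oo)%E ->
    Sop 1 0 u t \is a fin_num /\ Sop 0 1 u t \is a fin_num.
  move=> nu; rewrite Sop11E// => fu.
  by rewrite !ge0_fin_numE ?nnSop_ge0//; split; apply: le_lt_trans fu;
    rewrite ?leeDl ?leeDr ?nnSop_ge0.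
have [fv1 fv2] := fin _ nv fv; have [fw1 fw2] := fin _ nw fw.
have [d1 h1] := Sop_dist ler01 (lexx 0) t0 nv nw fv1 fw1.
have [d2 h2] := Sop_dist (lexx 0) ler01 t0 nv nw fv2 fw2.
have nd := nnmeas_dist nv nw.
split.
  by rewrite Sop11E// lte_add_pinfty// -ge0_fin_numE ?nnSop_ge0.
rewrite !PhiE// -mulrBr normrM Sop11E// (fineD d1 d2).
have p0 : 0 <= 3 / (alpha * pi) / rtan t ^+ 2.
  by rewrite divr_ge0 ?sqr_ge0// divr_ge0// mulr_ge0 ?pi_ge0// ltW.
rewrite (ger0_norm p0) ler_wpM2l//.
apply: le_trans (lerD h1 h2); apply: sin_div_expR_lipschitz.
- by rewrite fine_ge0// nnSop_ge0.
- by rewrite fine_ge0// nnSop_ge0.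
Qed.

Lemma Phi_ae_eq alpha v w t : I0 t -> measurable_fun (@I0 R) v ->
  measurable_fun (@I0 R) w -> {ae mu, forall x, I0 x -> v x = w x} ->
  Phi alpha v t = Phi alpha w t.
Proof.
move=> t0 mv mw vw.
have mK : measurable_fun (@I0 R) (fun s => Kker s t).
  by apply: measurable_funTS; exact: measurable_Kker1.
have ml : measurable_fun (@I0 R) (fun s => (s < t)%R%:R : R).
  by apply: measurable_funTS; exact: measurable_ltl.
have E (g : R -> R) : measurable_fun (@I0 R) g ->
    (\int[mu]_(s in @I0 R) (g s * v s)%:E = \int[mu]_(s in @I0 R) (g s * w s)%:E)%E.
  move=> mg; apply: ae_eq_integral.
  - exact: measurable_I0.
  - by apply/measurable_EFinP; exact: measurable_funM.
  - by apply/measurable_EFinP; exact: measurable_funM.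
  - apply: filterS vw; first exact: (ae_filter_ringOfSetsType mu).
    by move=> x h x0; rewrite h.
rewrite /Phi /Hop /Rintegral (E _ mK) !integral0tE// E//.
Qed.

End Phi_estimates.

(** * Uniqueness *)

Section uniqueness.
Variables (R : realType) (alpha : R).
Hypothesis halpha : 8 / pi < alpha.
Notation mu := (@lebesgue_measure R).
Implicit Types (s t : R) (v w : R -> R).

Lemma alphapi_gt8 : 8 < alpha * pi.
Proof. by rewrite -ltr_pdivrMr ?pi_gt0. Qed.

Lemma alpha_gt0 : 0 < alpha.
Proof. by apply: lt_trans halpha; rewrite divr_gt0 ?pi_gt0. Qed.

Definition sqnorm v := (\int[mu]_(s in @I0 R) (v s ^+ 2)%:E)%E.

Lemma measurable_sqr v : measurable_fun setT v ->
  measurable_fun (@I0 R) (fun s => (v s ^+ 2)%:E).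
Proof.
by move=> mv; apply/measurable_EFinP; apply: measurable_funTS; exact: measurable_funX.
Qed.

Lemma sqnorm_ge0 v : (0 <= sqnorm v)%E.
Proof. by apply: integral_ge0 => s _; rewrite lee_fin sqr_ge0. Qed.

Lemma measurable_schur_lhs v : nnmeas v -> measurable_fun (@I0 R)
  (fun t => ((rtan t ^+ 4)^-1%:E * (Sop 1 1 v t * Sop 1 1 v t))%E).
Proof.
move=> [mv v0]; have mS := measurable_Sop ler01 ler01 mv v0.
apply: emeasurable_funM; last exact: emeasurable_funM.
by apply/measurable_EFinP; apply: measurable_funTS; exact: measurable_invr.
Qed.

Lemma schur_lhs_ge0 v t : nnmeas v -> I0 t ->
  (0 <= (rtan t ^+ 4)^-1%:E * (Sop 1 1 v t * Sop 1 1 v t))%E.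
Proof.
move=> [mv v0] t0; have pt := rtan_gt0 t0.
by rewrite mule_ge0 ?mule_ge0 ?Sop_ge0// lee_fin invr_ge0 exprn_ge0// ltW.
Qed.

(** Schur's bound makes the weighted square integrable, hence finite almost everywhere, and the
    weight is positive. *)
Lemma ae_Sop_fin v : nnmeas v -> (sqnorm v < +oo)%E ->
  {ae mu, forall t, I0 t -> (Sop 1 1 v t < +oo)%E}.
Proof.
move=> nv fv; have [mv v0] := nv.
have i : mu.-integrable (@I0 R) (fun t => ((rtan t ^+ 4)^-1%:E * (Sop 1 1 v t * Sop 1 1 v t))%E).
  apply/integrableP; split; first exact: measurable_schur_lhs.
  rewrite (_ : (\int[mu]_(x in _) _)%E =
      (\int[mu]_(t in @I0 R) ((rtan t ^+ 4)^-1%:E * (Sop 1 1 v t * Sop 1 1 v t)))%E); last first.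
    by apply: eq_integral => t; rewrite inE => t0; rewrite gee0_abs// schur_lhs_ge0.
  apply: (le_lt_trans (schur ltr01 ler01 mv v0)).
  by rewrite lte_mul_pinfty// lee_fin sqr_ge0.
have : {ae mu, forall t, I0 t ->
    ((rtan t ^+ 4)^-1%:E * (Sop 1 1 v t * Sop 1 1 v t))%E \is a fin_num}.
  by apply: integrable_ae i; exact: measurable_I0.
apply: filterS; first exact: (ae_filter_ringOfSetsType mu).
move=> t h t0; have := h t0; rewrite ltNge leye_eq; apply: contraL => /eqP ->.
have pt := rtan_gt0 t0.
by rewrite mulyy gt0_muley// lte_fin invr_gt0 exprn_gt0.
Qed.

Lemma fixpoint_unique v w : nnmeas v -> nnmeas w ->
  (sqnorm v < +oo)%E -> (sqnorm w < +oo)%E ->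
  {ae mu, forall t, I0 t -> v t = Phi alpha v t} ->
  {ae mu, forall t, I0 t -> w t = Phi alpha w t} ->
  {ae mu, forall t, I0 t -> v t = w t}.
Proof.
move=> nv nw fv fw ev ew; have [mv v0] := nv; have [mw w0] := nw.
pose d s := `|v s - w s|.
have nd : nnmeas d := nnmeas_dist nv nw; have [md d0] := nd.
have fd : (sqnorm d < +oo)%E.
  (* For non-negative v and w, (v - w)^2 <= v^2 + w^2. *)
  apply: (@le_lt_trans _ _ (sqnorm v + sqnorm w)%E); last by rewrite lte_add_pinfty.
  rewrite /sqnorm -ge0_integralD.
  - apply: (@le_integral_I0 R (fun s => d s ^+ 2) (fun s => v s ^+ 2 + w s ^+ 2)).
    + exact: measurable_funX.
    + by apply: measurable_funD; exact: measurable_funX.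
    + move=> s s0; rewrite sqr_ge0/= /d real_normK ?num_real//.
      by have := v0 _ s0; have := w0 _ s0; nra.
  - exact: measurable_I0.
  - by move=> s _; rewrite lee_fin sqr_ge0.
  - exact: measurable_sqr.
  - by move=> s _; rewrite lee_fin sqr_ge0.
  - exact: measurable_sqr.
have al := alphapi_gt8; have al0 := alpha_gt0.
pose k := 3 / (alpha * pi).
have k0 : 0 <= k by rewrite divr_ge0//; lra.
have kd : (sqnorm d <= ((k * (8 / 3)) ^+ 2)%:E * sqnorm d)%E.
  apply: (@le_trans _ _ ((k ^+ 2)%:E * \int[mu]_(t in @I0 R)
     ((rtan t ^+ 4)^-1%:E * (Sop 1 1 d t * Sop 1 1 d t)))%E).
    rewrite -ge0_integralZl_EFin; first last.
    - exact: sqr_ge0.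
    - exact: measurable_schur_lhs.
    - by move=> t t0; exact: schur_lhs_ge0.
    - exact: measurable_I0.
    apply: ae_ge0_le_integral.
    - exact: measurable_I0.
    - by move=> s _; rewrite lee_fin sqr_ge0.
    - exact: measurable_sqr.
    - by move=> t t0; rewrite mule_ge0 ?schur_lhs_ge0// lee_fin sqr_ge0.
    - by apply: measurable_funeM; exact: measurable_schur_lhs.
    have aeF : Filter (nbhs (almost_everywhere mu)) by exact: (ae_filter_ringOfSetsType mu).
    have := filterI (filterI ev ew) (filterI (ae_Sop_fin nv fv) (ae_Sop_fin nw fw)).
    move=> /(_ aeF aeF aeF); apply: filterS.
    move=> t [[et1 et2] [ft1 ft2]] t0; have pt := rtan_gt0 t0.
    have [f3 h] := Phi_lipschitz al0 t0 nv nw (ft1 t0) (ft2 t0).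
    rewrite -et1// -et2// -/(d t) -/k in h.
    have fD : Sop 1 1 d t \is a fin_num by rewrite ge0_fin_numE// Sop_ge0.
    rewrite -(fineK fD) -!EFinM lee_fin.
    have -> : k ^+ 2 * ((rtan t ^+ 4)^-1 * (fine (Sop 1 1 d t) * fine (Sop 1 1 d t))) =
      (k / rtan t ^+ 2 * fine (Sop 1 1 d t)) ^+ 2.
      by field; rewrite gt_eqF.
    by apply: lerXn2r; rewrite ?nnegrE; [exact: d0|exact: le_trans (d0 t t0) h|exact: h].
  apply: (@le_trans _ _ ((k ^+ 2)%:E * (((1 * (2 / 3) + 1 * 2) ^+ 2)%:E * sqnorm d))%E).
    by apply: lee_wpmul2l; [rewrite lee_fin sqr_ge0|exact: schur].
  rewrite muleA -EFinM.
  by have -> : k ^+ 2 * (1 * (2 / 3) + 1 * 2) ^+ 2 = (k * (8 / 3)) ^+ 2 by field.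
have q1 : (k * (8 / 3)) ^+ 2 < 1.
  have q0 : 0 <= k * (8 / 3) by rewrite mulr_ge0.
  rewrite expr_lt1//.
  rewrite /k mulrAC ltr_pdivrMr; lra.
(* A finite non-negative number bounded by a fraction less than 1 of itself vanishes; this is where
   [fd] enters. *)
have d_eq0 : sqnorm d = 0%E.
  have := sqnorm_ge0 d; case: (sqnorm d) fd kd => // r _.
  rewrite -EFinM !lee_fin => h r0; congr EFin; nra.
have mD := measurable_sqr md.
have : ae_eq mu (@I0 R) (fun t => (d t ^+ 2)%:E) (cst 0%E).
  apply/ae_eq_integral_abs; [exact: measurable_I0|exact: mD|].
  rewrite -[RHS]d_eq0; apply: eq_integral => t _.
  by rewrite gee0_abs// lee_fin sqr_ge0.
apply: filterS.
move=> t h t0; have /eqP := h t0; rewrite eqe sqrf_eq0 normr_eq0 subr_eq0.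
by move/eqP.
Qed.

End uniqueness.

(** * Existence *)

Section existence.
Variables (R : realType) (alpha : R).
Hypothesis halpha : 8 / pi < alpha.
Notation mu := (@lebesgue_measure R).
Implicit Types (a b D s t : R) (v w : R -> R) (n m : nat).

Let k : R := 3 / (alpha * pi).
Let q : R := 8 / (alpha * pi).

Let k_ge0 : 0 <= k.
Proof. by have := alphapi_gt8 halpha; rewrite /k => ?; rewrite divr_ge0//; lra. Qed.

Let k_le : k <= 3 / 8.
Proof.
have := alphapi_gt8 halpha; rewrite /k => ?.
by rewrite ler_pM2l// lef_pV2 ?posrE//; lra.
Qed.

Let q_ge0 : 0 <= q.
Proof. by have := alphapi_gt8 halpha; rewrite /q => ?; rewrite divr_ge0//; lra. Qed.

Let q_lt1 : q < 1.
Proof. by have := alphapi_gt8 halpha => ?; rewrite ltr_pdivrMr; lra. Qed.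

Lemma Sop_le_invr a b D w t : 0 <= a -> 0 <= b -> 0 <= D -> I0 t -> nnmeas w ->
  (forall s, I0 s -> w s <= D / rtan s) ->
  (Sop a b w t <= (D * ((a * (2 / 3) + b * 2) * rtan t))%:E)%E.
Proof.
move=> a0 b0 D0 t0 nw wD.
apply: (@le_trans _ _ (\int[mu]_(s in @I0 R) (D%:E * (skern a b s t / rtan s)%:E))%E).
  apply: (@le_integral_I0 R (fun s => skern a b s t * w s) (fun s => D * (skern a b s t / rtan s))).
  - by apply: measurable_funM; [exact: measurable_skern1|exact: nw.1].
  - apply: measurable_funM => //.
    by apply: measurable_funM; [exact: measurable_skern1|exact: (@measurable_invr R 1)].
  - move=> s s0; have k0 := skern_ge0 a0 b0 s0 t0.
    by rewrite mulr_ge0 ?nw.2//= mulrCA ler_wpM2l// wD.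
rewrite ge0_integralZl_EFin//; first last.
- apply/measurable_EFinP; apply: measurable_funTS.
  by apply: measurable_funM; [exact: measurable_skern1|exact: (@measurable_invr R 1)].
- by move=> s s0; rewrite lee_fin divr_ge0 ?skern_ge0// ltW// rtan_gt0.
- exact: measurable_I0.
by rewrite EFinM lee_wpmul2l ?lee_fin// integral_skern_invr.
Qed.

(* This bound is invariant since [3/8 * (1 + 1/3) = 1/2]; see [below_Phi_le_invr]. *)
Definition below w := nnmeas w /\ forall s, I0 s -> w s <= 2^-1 / rtan s.

(** The bound growing with [rtan t], from 1/2 times 2/3, serves the invariance of [below]. The
    uniform bound 1/3 keeps the argument of the sine in [0, pi], so that [Phi] stays
    non-negative. *)
Lemma below_Sop10 w t : below w -> I0 t ->
  [/\ Sop 1 0 w t \is a fin_num, 0 <= fine (Sop 1 0 w t), fine (Sop 1 0 w t) <= rtan t / 3 &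
      fine (Sop 1 0 w t) <= 3^-1].
Proof.
move=> [nw wb] t0; have pt := rtan_gt0 t0.
have h20 : (0 : R) <= 2^-1 by rewrite invr_ge0.
have h1 := Sop_le_invr ler01 (lexx 0) h20 t0 nw wb.
have S0 := nnSop_ge0 ler01 (lexx 0) t0 nw.
have fS : Sop 1 0 w t \is a fin_num.
  by rewrite ge0_fin_numE//; apply: le_lt_trans h1 (ltry _).
have h2 : fine (Sop 1 0 w t) <= rtan t / 3.
  rewrite -lee_fin fineK//; apply: le_trans h1 _; rewrite lee_fin; lra.
split=> //; first exact: fine_ge0.
have [t1|t1] := leP (rtan t) 1; first by apply: le_trans h2 _; rewrite ler_piMl// invr_ge0.
(* Near [pi / 2], where [rtan] is unbounded, [1 / rtan <= (1 + tan^2) / (2 rtan^3)] helps. *)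
have [_ h3] := integral_Kker_invr_le t0.
have p0 := pi_gt0 R.
have : (Sop 1 0 w t <= ((6 * pi)^-1)%:E * (pi / rtan t)%:E)%E.
  apply: (@le_trans _ _ (((6 * pi)^-1)%:E * \int[mu]_(s in @I0 R) (Kker s t / rtan s)%:E)%E);
    last by apply: lee_wpmul2l => //; rewrite lee_fin invr_ge0; lra.
  rewrite -ge0_integralZl_EFin; first last.
  - by rewrite invr_ge0; lra.
  - apply/measurable_EFinP; apply: measurable_funTS.
    by apply: measurable_funM; [exact: measurable_Kker1|exact: (@measurable_invr R 1)].
  - by move=> s s0; rewrite lee_fin divr_ge0 ?Kker_ge0// ltW// rtan_gt0.
  - exact: measurable_I0.
  apply: (@le_integral_I0 R (fun s => skern 1 0 s t * w s) (fun s => (6 * pi)^-1 * (Kker s t / rtan s))).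
  - by apply: measurable_funM; [exact: measurable_skern1|exact: nw.1].
  - apply: measurable_funM => //.
    by apply: measurable_funM; [exact: measurable_Kker1|exact: (@measurable_invr R 1)].
  - move=> s s0; have k0 := skern_ge0 ler01 (lexx 0) s0 t0.
    rewrite mulr_ge0 ?nw.2//= (_ : (6 * pi)^-1 * (Kker s t / rtan s) =
      skern 1 0 s t * (2^-1 / rtan s)); first by rewrite ler_wpM2l// wb.
    have ps := rtan_gt0 s0.
    rewrite /skern mul0r addr0; move: (pi : R) p0 => p p0.
    by field; rewrite !gt_eqF.
rewrite -{1}(fineK fS) -EFinM lee_fin => /le_trans; apply.
have -> : (6 * pi)^-1 * (pi / rtan t) = 6^-1 / rtan t.
  by move: (pi : R) p0 => p p0; field; rewrite !gt_eqF.
rewrite ler_pdivrMr//; lra.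
Qed.

Lemma below_Sop11 w t : below w -> I0 t -> (Sop 1 1 w t < +oo)%E.
Proof.
move=> [nw wb] t0; have h20 : (0 : R) <= 2^-1 by rewrite invr_ge0.
exact: le_lt_trans (Sop_le_invr ler01 ler01 h20 t0 nw wb) (ltry _).
Qed.

Lemma below_Phi_ge0 w t : below w -> I0 t -> 0 <= Phi alpha w t.
Proof.
move=> bw t0; have [_ x0 _ x1] := below_Sop10 bw t0.
have nw := bw.1; rewrite PhiE//.
rewrite mulr_ge0//.
  by rewrite divr_ge0 ?sqr_ge0// -/k.
rewrite divr_ge0 ?expR_ge0// sin_ge0_pi//.
by move: t0; rewrite I0E; have := pi_ge2 R; lra.
Qed.

(** The exponential is dropped, sin (t + x) <= sin t + x, and cot t sin t = cos t. Only the H part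
    remains, which is why the constant 2/3 governs both the invariance of [below] and the L^2
    bound. *)
Lemma below_Phi_le w t : below w -> I0 t ->
  Phi alpha w t <= 3 / 8 * (cos t + fine (Sop 1 0 w t) / rtan t ^+ 2).
Proof.
move=> bw t0; have [_ x0 _ x1] := below_Sop10 bw t0.
have := bw.1 => nw; have pt := rtan_gt0 t0.
rewrite PhiE// -/k; set x := fine (Sop 1 0 w t); set y := fine _.
have y0 : 0 <= y by rewrite fine_ge0// nnSop_ge0.
have [s0 c0] := sin_cos_gt0 t0.
have sx : sin (t + x) <= sin t + x.
  have := sin_lipschitz (t + x) t.
  have -> : t + x - t = x by ring.
  by rewrite (ger0_norm x0) ler_norml => /andP[_]; rewrite lerBlDl.
have sx0 : 0 <= sin (t + x).
  by rewrite sin_ge0_pi//; move: t0; rewrite I0E; have := pi_ge2 R; rewrite /x; lra.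
have e1 : (expR y)^-1 <= 1 by rewrite invf_le1 ?expR_gt0// -expR0 ler_expR.
have h : sin (t + x) / expR y <= sin t + x.
  by apply: le_trans sx; rewrite ler_piMr.
have -> : cos t + x / rtan t ^+ 2 = (sin t + x) / rtan t ^+ 2.
  rewrite sqr_rtan// /tan; by field; rewrite !gt_eqF.
have r0 : 0 <= (rtan t ^+ 2)^-1 by rewrite invr_ge0 sqr_ge0.
rewrite -[leLHS]mulrA; apply: ler_pM => //.
  by rewrite mulr_ge0// divr_ge0 ?expR_ge0.
by rewrite mulrC; apply: ler_wpM2r.
Qed.

Lemma below_Phi_le_invr w t : below w -> I0 t -> Phi alpha w t <= 2^-1 / rtan t.
Proof.
move=> bw t0; have [_ x0 x1 _] := below_Sop10 bw t0.
apply: le_trans (below_Phi_le bw t0) _.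
have pt := rtan_gt0 t0; have [s0 c0] := sin_cos_gt0 t0.
(* After multiplying by [rtan t] and squaring, this is cos t sin t <= 1. *)
have hc : cos t <= (rtan t)^-1.
  rewrite -[leRHS]mul1r ler_pdivlMr//.
  rewrite -(@ler_pXn2r _ 2)// ?nnegrE ?mulr_ge0 ?(ltW c0) ?(ltW pt)//.
  rewrite exprMn sqr_rtan// expr1n /tan.
  have -> : cos t ^+ 2 * (sin t / cos t) = cos t * sin t by field; rewrite gt_eqF.
  by apply: mulr_ile1 (ltW c0) (ltW s0) (cos_le1 t) (sin_le1 t).
have hx : fine (Sop 1 0 w t) / rtan t ^+ 2 <= 3^-1 / rtan t.
  apply: (@le_trans _ _ (rtan t / 3 / rtan t ^+ 2)).
    by rewrite ler_pM2r// invr_gt0 exprn_gt0.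
  by rewrite le_eqVlt; apply/orP; left; apply/eqP; field; rewrite gt_eqF.
lra.
Qed.

(** Restriction keeps the iterates measurable on the whole line and constantly 0 off the
    interval. *)
Definition Phi0 w := (Phi alpha w) \_ (@I0 R).

Lemma Phi0E w t : I0 t -> Phi0 w t = Phi alpha w t.
Proof. by move=> t0; rewrite /Phi0 patchE ifT// inE. Qed.

Lemma measurable_Phi0 w : nnmeas w -> measurable_fun setT (Phi0 w).
Proof.
move=> nw; have [mw w0] := nw.
apply/(measurable_restrictT _ _).1; first exact: measurable_I0.
apply: (@eq_measurable_fun _ _ _ _ _ (fun t => 3 / (alpha * pi) / rtan t ^+ 2 *
    (sin (t + fine (Sop 1 0 w t)) / expR (fine (Sop 0 1 w t))))).
  by move=> t; rewrite inE => t0; rewrite PhiE.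
have mf a b : 0 <= a -> 0 <= b -> measurable_fun (@I0 R) (fun t => fine (Sop a b w t)).
  move=> a0 b0; have := measurable_Sop a0 b0 mw w0.
  by apply: measurableT_comp; exact: fine_measurable.
have ms : measurable_fun [set: R] (@sin R).
  by apply: continuous_measurable_fun; exact: continuous_sin.
apply: measurable_funM.
  apply: measurable_funM => //; apply: measurable_funTS; exact: measurable_invr.
apply: measurable_funM.
  apply: (measurableT_comp ms); apply: measurable_funD; first exact: measurable_id.
  exact: mf.
apply: (measurableT_comp (@measurable_inv R)).
by apply: (measurableT_comp (@measurable_expR R)); exact: mf.
Qed.

Lemma below_Phi0 w : below w -> below (Phi0 w).
Proof.
move=> bw; split; last by move=> s s0; rewrite Phi0E// below_Phi_le_invr.
split; first by apply: measurable_Phi0; exact: bw.1.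
by move=> s s0; rewrite Phi0E// below_Phi_ge0.
Qed.

Lemma Phi_contraction D v w t : 0 <= D -> below v -> below w -> I0 t ->
  (forall s, I0 s -> `|v s - w s| <= D / rtan s) ->
  `|Phi alpha v t - Phi alpha w t| <= q * D / rtan t.
Proof.
move=> D0 bv bw t0 vw; have pt := rtan_gt0 t0.
have := Phi_lipschitz (alpha_gt0 halpha) t0 bv.1 bw.1 (below_Sop11 bv t0) (below_Sop11 bw t0).
move=> [fS] /le_trans; apply; rewrite -/k.
have nd := nnmeas_dist bv.1 bw.1.
have h := Sop_le_invr ler01 ler01 D0 t0 nd vw.
have fin : Sop 1 1 (fun s => `|v s - w s|) t \is a fin_num.
  by rewrite ge0_fin_numE// nnSop_ge0.
rewrite -(fineK fin) lee_fin in h.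
apply: (@le_trans _ _ (k / rtan t ^+ 2 * (D * ((1 * (2 / 3) + 1 * 2) * rtan t)))).
  by rewrite ler_wpM2l// divr_ge0// sqr_ge0.
have -> : q = k * (8 / 3).
  by rewrite /q /k; move: (_ * _)^-1 => z; field.
by rewrite le_eqVlt; apply/orP; left; apply/eqP; field; rewrite gt_eqF.
Qed.

Let cvg_q : q ^+ n @[n --> \oo] --> (0 : R).
Proof. by apply: cvg_expr; rewrite ger0_norm. Qed.

Definition iterPhi n : R -> R := iter n Phi0 (cst 0).
Let z := iterPhi.

Lemma below_iterPhi n : below (z n).
Proof.
elim: n => [|n ih]; last exact: below_Phi0.
by split; [split|] => // s s0; rewrite /z/= divr_ge0 ?invr_ge0// ltW// rtan_gt0.
Qed.

Lemma iterPhiS n t : I0 t -> z n.+1 t = Phi alpha (z n) t.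
Proof. by move=> t0; rewrite /z /iterPhi iterS Phi0E. Qed.

(** The zeroth iterate is 0 and every other lies between 0 and 1 / (2 r), so the case n = 0 holds
    for all m at once. Applying the contraction n times then gives the Cauchy estimate without
    summing a geometric series. *)
Lemma iterPhi_dist n m t : I0 t -> `|z n t - z (n + m) t| <= q ^+ n / 2 / rtan t.
Proof.
elim: n m t => [|n ih] m t t0.
  rewrite expr0 mul1r add0n /z/= sub0r normrN.
  have [[_ w0] w1] := below_iterPhi m.
  by rewrite ger0_norm ?w0// w1.
rewrite addSn !iterPhiS// (_ : q ^+ n.+1 / 2 = q * (q ^+ n / 2)); last by rewrite exprS mulrA.
apply: Phi_contraction => //; try exact: below_iterPhi.
  by rewrite divr_ge0// exprn_ge0.
by move=> s s0; exact: ih.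
Qed.

Let cvg_qr c : q ^+ n * c @[n --> \oo] --> (0 : R).
Proof. by rewrite -[X in _ --> X](mul0r c); apply: cvgM => //; exact: cvg_cst. Qed.

Lemma is_cvg_iterPhi t : cvgn (z ^~ t).
Proof.
have [t0|nt0] := pselect (I0 t); last first.
  apply: (@is_cvg_near_cst _ _ 0); apply: nearW => -[//|n] /=.
  by rewrite /z /iterPhi/= /Phi0 patchE ifF//; apply/negbTE/negP; rewrite inE.
apply: cauchy_cvg; apply: cauchy_exP => e e0.
have [n _ hn] : \forall n \near \oo, q ^+ n * (2^-1 / rtan t) < e.
  by apply: cvgr_lt (cvg_qr _) _ e0.
exists (z n t); exists n => // m /= nm.
rewrite /ball/= -(subnKC nm); apply: le_lt_trans (iterPhi_dist _ _ t0) _.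
by rewrite -mulrA; exact: (hn n (leqnn n)).
Qed.

Definition limPhi t := limn (z ^~ t).

Lemma iterPhi_cvg t : z n t @[n --> \oo] --> limPhi t.
Proof. exact: is_cvg_iterPhi. Qed.

Lemma iterPhi_lim_dist n t : I0 t -> `|z n t - limPhi t| <= q ^+ n / 2 / rtan t.
Proof.
move=> t0.
have : `|z n t - z m t| @[m --> \oo] --> `|z n t - limPhi t|.
  by apply: cvg_norm; apply: cvgB; [exact: cvg_cst|exact: iterPhi_cvg].
move=> /cvgr_to_le; apply; exists n => // m /= nm.
by rewrite -(subnKC nm); exact: iterPhi_dist.
Qed.

Lemma below_limPhi : below limPhi.
Proof.
split; first split.
- apply: (@measurable_fun_cvg _ _ _ _ z) => [n|t _]; last exact: iterPhi_cvg.
  by have [[]] := below_iterPhi n.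
- move=> s s0; have /cvgr_to_ge := @iterPhi_cvg s; apply; apply: nearW => n.
  by have [[_ ->]] := below_iterPhi n.
- move=> s s0; have /cvgr_to_le := @iterPhi_cvg s; apply; apply: nearW => n.
  by have [_ ->] := below_iterPhi n.
Qed.

Lemma limPhi_fixpoint t : I0 t -> limPhi t = Phi alpha limPhi t.
Proof.
move=> t0; apply/eqP; rewrite -subr_eq0 -normr_le0.
(* The limit and its image each lie within [q ^+ n.+1 / 2 / rtan t] of the iterate of index [n.+1],
   so their distance is at most [q ^+ n / rtan t] for every n. *)
have /cvgr_to_ge := @cvg_qr (1 / rtan t); apply; apply: nearW => n.
have h1 := iterPhi_lim_dist n.+1 t0.
have D0 : 0 <= q ^+ n / 2 by rewrite divr_ge0// exprn_ge0.
have h2 := Phi_contraction D0 (below_iterPhi n) below_limPhi t0 (iterPhi_lim_dist n).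
rewrite -iterPhiS// in h2.
have pt := rtan_gt0 t0.
have hq : q ^+ n.+1 / 2 / rtan t <= q ^+ n / 2 / rtan t.
  rewrite ler_pM2r ?invr_gt0// ler_pM2r// exprS ler_piMl ?exprn_ge0//.
  exact: ltW.
have h3 : q * (q ^+ n / 2) / rtan t = q ^+ n.+1 / 2 / rtan t by rewrite exprS !mulrA.
rewrite -/q h3 in h2.
have -> : limPhi t - Phi alpha limPhi t =
  (z n.+1 t - Phi alpha limPhi t) - (z n.+1 t - limPhi t) by ring.
apply: (le_trans (ler_normB _ _)).
lra.
Qed.

(** By [below_Phi_le] the next iterate is at most 3/8 (1 + y) with y = cot t times the H part, and
    (1 + y)^2 <= 2 (1 + y^2). Schur's constant 4/9 for y^2 and the length [pi / 2] of the interval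
    give at most 9/32 (pi / 2 + 4/9), less than 11/16. *)
Lemma sqnorm_iterPhi n : (sqnorm (z n) <= 1)%E.
Proof.
elim: n => [|n ih].
  by rewrite /sqnorm integral0_eq// => s _; rewrite /z/= expr0n.
have bz := below_iterPhi n; have nz := bz.1; have [mz z0] := nz.
have mS := measurable_Sop ler01 (lexx 0) mz z0.
have mE : measurable_fun (@I0 R) (fun t => ((rtan t ^+ 4)^-1%:E * (Sop 1 0 (z n) t * Sop 1 0 (z n) t))%E).
  apply: emeasurable_funM; last exact: emeasurable_funM.
  by apply/measurable_EFinP; apply: measurable_funTS; exact: measurable_invr.
have E0 t : I0 t -> (0 <= (rtan t ^+ 4)^-1%:E * (Sop 1 0 (z n) t * Sop 1 0 (z n) t))%E.
  move=> t0; have pt := rtan_gt0 t0.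
  by rewrite mule_ge0 ?mule_ge0 ?Sop_ge0// lee_fin invr_ge0 exprn_ge0// ltW.
apply: (@le_trans _ _ (\int[mu]_(t in @I0 R) (cst (9 / 32)%:E t +
  (9 / 32)%:E * ((rtan t ^+ 4)^-1%:E * (Sop 1 0 (z n) t * Sop 1 0 (z n) t))))%E).
  apply: ge0_le_integral.
  - exact: measurable_I0.
  - by move=> s _; rewrite lee_fin sqr_ge0.
  - by apply: measurable_sqr; have [[]] := below_iterPhi n.+1.
  - by apply: emeasurable_funD => //; exact: measurable_funeM.
  - move=> t t0; have [fS x0 _ _] := below_Sop10 bz t0; have pt := rtan_gt0 t0.
    rewrite /cst -(fineK fS) -!EFinM -EFinD lee_fin iterPhiS//.
    have h1 := below_Phi_ge0 bz t0.
    have h2 := below_Phi_le bz t0.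
    have [_ c0] := sin_cos_gt0 t0; have c1 := cos_le1 t.
    set x := fine _ in h2 *.
    have -> : (rtan t ^+ 4)^-1 * (x * x) = (x / rtan t ^+ 2) ^+ 2.
      by field; rewrite gt_eqF.
    have y0 : 0 <= x / rtan t ^+ 2 by rewrite divr_ge0// sqr_ge0.
    move: (x / _) y0 h2 => y y0 h2.
    apply: (@le_trans _ _ ((3 / 8 * (1 + y)) ^+ 2)).
      apply: lerXn2r; rewrite ?nnegrE//; first by rewrite mulr_ge0// addr_ge0.
      by apply: le_trans h2 _; lra.
    by have := sqr_ge0 (1 - y); nra.
rewrite ge0_integralD//; first last.
- exact: measurable_funeM.
- by move=> t t0; rewrite mule_ge0 ?E0// lee_fin.
- by move=> t _; rewrite lee_fin divr_ge0.
- exact: measurable_I0.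
rewrite integral_cst; last exact: measurable_I0.
rewrite ge0_integralZl_EFin//; last exact: measurable_I0.
have muI : (mu (@I0 R) = (pi / 2)%:E)%E.
  by rewrite /I0 lebesgue_measure_itv/= lte_fin divr_gt0 ?pi_gt0// sube0.
rewrite [X in (_ * X + _)%E](_ : _ = (pi / 2)%:E); last exact: muI.
have h := schur ltr01 (lexx 0) mz z0.
apply: (@le_trans _ _ ((9 / 32 * (pi / 2))%:E + (9 / 32)%:E * (((1 * (2 / 3) + 0 * 2) ^+ 2)%:E * 1%:E))%E).
  apply: leeD; first by rewrite -EFinM.
  apply: lee_wpmul2l; first by rewrite lee_fin.
  by apply: le_trans h _; apply: lee_wpmul2l; rewrite ?lee_fin ?sqr_ge0.
rewrite -!EFinM -EFinD lee_fin.
by have := pihalf_lt2 R; lra.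
Qed.

Lemma sqnorm_limPhi : (sqnorm limPhi <= 1)%E.
Proof.
have -> : sqnorm limPhi = (\int[mu]_(t in @I0 R) limn_einf (fun n => (z n t ^+ 2)%:E))%E.
  apply: eq_integral => t _.
  have c : (z n t ^+ 2)%:E @[n --> \oo] --> (limPhi t ^+ 2)%:E.
    by apply: cvg_EFin; [exact: nearW|rewrite expr2; apply: cvgM; exact: iterPhi_cvg].
  by rewrite (cvg_limn_einf_sup c).1.
apply: le_trans (fatou _ _ _ _) _.
- exact: measurable_I0.
- by move=> n; apply: measurable_sqr; have [[]] := below_iterPhi n.
- by move=> n t _; rewrite lee_fin sqr_ge0.
rewrite limn_einf_lim; apply: lime_le; first exact: is_cvg_einfs.
apply: nearW => n; apply: le_trans (sqnorm_iterPhi n).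
by apply: ereal_inf_lbound; exists n => //=.
Qed.

End existence.

Theorem theorem3p8 (R : realType) (alpha : R) (halpha : 8 / pi < alpha) :
  exists zeta : R -> R,
    nonneg_solution alpha zeta /\
    (forall zeta' : R -> R, nonneg_solution alpha zeta' ->
       {ae (@lebesgue_measure R), forall x, I0 x -> zeta' x = zeta x}).
Proof.
have bl := below_limPhi halpha; have nl := bl.1; have [ml l0] := nl.
have fl : (sqnorm (limPhi alpha) < +oo)%E := le_lt_trans (sqnorm_limPhi halpha) (ltry _).
exists (limPhi alpha); split.
  split.
  - split; first exact: measurable_funTS.
    apply/integrableP; split; first exact: measurable_sqr.
    apply: le_lt_trans fl; rewrite le_eqVlt; apply/orP; left; apply/eqP.
    by apply: eq_integral => t _; rewrite gee0_abs// lee_fin sqr_ge0.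
  - by apply: aeW => t; exact: l0.
  - by apply: aeW => t; exact: limPhi_fixpoint.
move=> z [[mz iz] z0 ez].
(* A solution is non-negative only almost everywhere and measurable only on the interval. This
   representative satisfies [nnmeas], and [Phi] does not see the change. *)
pose v := (fun t => `|z t|) \_ (@I0 R).
have vE t : I0 t -> v t = `|z t| by move=> t0; rewrite /v patchE ifT// inE.
have mv : measurable_fun setT v.
  apply/(measurable_restrictT _ _).1; first exact: measurable_I0.
  exact: measurableT_comp.
have nv : nnmeas v by split=> // t t0; rewrite vE.
have fv : (sqnorm v < +oo)%E.
  move/integrableP : iz => [_]; apply: le_lt_trans; rewrite le_eqVlt; apply/orP; left; apply/eqP.
  apply: eq_integral => t; rewrite inE => t0.
  by rewrite vE// real_normK ?num_real// gee0_abs// lee_fin sqr_ge0.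
have aeF : Filter (nbhs (almost_everywhere (@lebesgue_measure R))).
  exact: (ae_filter_ringOfSetsType (@lebesgue_measure R)).
have zv : {ae (@lebesgue_measure R), forall t, I0 t -> z t = v t}.
  by apply: filterS z0 => t h t0; rewrite vE// ger0_norm// h.
have ev : {ae (@lebesgue_measure R), forall t, I0 t -> v t = Phi alpha v t}.
  have := filterI zv ez; move=> /(_ aeF); apply: filterS => t [h1 h2] t0.
  rewrite -h1// h2//; apply: Phi_ae_eq => //; exact: measurable_funTS.
have el : {ae (@lebesgue_measure R), forall t, I0 t -> limPhi alpha t = Phi alpha (limPhi alpha) t}.
  by apply: aeW => t; exact: limPhi_fixpoint.
have vl := fixpoint_unique halpha nv nl fv fl ev el.
have := filterI zv vl; move=> /(_ aeF); apply: filterS => t [h1 h2] t0.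
by rewrite h1// h2.
Qed.
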